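(* Let $J$ be one of $\mathbb Z$, $\mathbb Z_+=\{n\in\mathbb Z:n\ge0\}$, $\mathbb Z_-=\{n\in\mathbb Z:n\le0\}$, let $\mathbf a=(a_n)_{n\in J}\subset(0,\infty)$ be an increasing sequence satisfying $a_{n+1}\ge2a_n$ for $n\in J$ if $J=\mathbb Z$ or $J=\mathbb Z_+$, and $a_n\ge2a_{n-1}$ for $n\in J$ if $J=\mathbb Z_-$, and let $\mathcal T_{\mathbf a}=(T_{\mathbf a}(t))_{t\ge0}$ be the associated Packel-type semigroup on $L^2(\mathbb R_+)\oplus L^2(\mathbb R_+)$ described in the context. Then: (i) for $t>0$, $T_{\mathbf a}(t)$ is similar to a contraction if and only if $J=\mathbb Z_-$; (ii) $\mathcal T_{\mathbf a}$ is similar to a quasi-contraction semigroup if and only if $J=\mathbb Z_+$.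
   Context: Construction. For $t>0$: if there is $n\in J$ with $a_n<t\le a_{n+1}$, set $n_0(t)=n$; otherwise, if $J=\mathbb Z_-$ and $t>a_0$ set $n_0(t)=0$, and if $J=\mathbb Z_+$ and $t\le a_0$ set $n_0(t)=-1$ with the convention $a_{-1}=0$. For $n\in J$ with $n>n_0(t)$ put $I_n(t)=(a_n-t,a_n]$, and put $I_{n_0(t)}(t)=[0,2a_{n_0(t)}-t]$. Define $V_{\mathbf a}(t)\in\mathcal L(L^2(\mathbb R_+))$ by $(V_{\mathbf a}(t)f)(x)=f(2a_n-x-t)$ if $x\in I_n(t)$ for some $n\ge n_0(t)$ (with $n\in J$ or $n=n_0(t)$), and $(V_{\mathbf a}(t)f)(x)=0$ otherwise; $V_{\mathbf a}(0)=0$. Let $R(t)$ and $L(t)$ be the right and left shifts on $L^2(\mathbb R_+)$: $(R(t)f)(x)=f(x-t)\chi_{[0,\infty)}(x-t)$, $(L(t)f)(x)=f(x+t)$. Set $T_{\mathbf a}(t)=\begin{pmatrix}L(t)&V_{\mathbf a}(t)\\0&R(t)\end{pmatrix}$ on $L^2(\mathbb R_+)\oplus L^2(\mathbb R_+)$; this is a bounded $C_0$-semigroup. An operator $T$ is similar to a contraction if $\|STS^{-1}\|\le1$ for some bounded invertible $S$; a $C_0$-semigroup $(T(t))$ is similar to a quasi-contraction semigroup if there are a bounded invertible $S$ and $\lambda\in\mathbb R$ with $\|ST(t)S^{-1}\|\le e^{\lambda t}$ for all $t\ge0$. *)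

(* Defs.v *)
From HB Require Import structures.
From mathcomp Require Import all_boot all_order all_algebra.
From mathcomp Require Import all_classical all_reals all_analysis.
From mathcomp Require Import complex.

Set Implicit Arguments.
Unset Strict Implicit.
Unset Printing Implicit Defensive.

Import Order.TTheory GRing.Theory Num.Theory.
Import numFieldNormedType.Exports.
Local Open Scope classical_set_scope.
Local Open Scope ring_scope.

Inductive index_kind := JZ | JZplus | JZminus.

Definition inJ (J : index_kind) (n : int) : bool :=
  match J with
  | JZ => true
  | JZplus => (0 <= n)%R
  | JZminus => (n <= 0)%R
  end.

(* Hypotheses on the sequence a = (a_n)_{n in J} (values outside J are
   irrelevant). *)
Definition admissible_seq (R : realType) (J : index_kind) (a : int -> R) : Prop :=
  (forall n, inJ J n -> 0 < a n) /\
  (forall m n, inJ J m -> inJ J n -> (m < n)%R -> a m < a n) /\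
  (match J with
   | JZ | JZplus => forall n, inJ J n -> 2 * a n <= a (n + 1)%R
   | JZminus => forall n, inJ J n -> 2 * a (n - 1)%R <= a n
   end).

(* a extended by the convention a_{-1} = 0 (only used when J = Z_+). *)
Definition aJ (R : realType) (J : index_kind) (a : int -> R) (n : int) : R :=
  if inJ J n then a n else 0.

Definition n0_spec (R : realType) (J : index_kind) (a : int -> R) (t : R) (n : int) : Prop :=
  (inJ J n /\ inJ J (n + 1)%R /\ a n < t <= a (n + 1)%R) \/
  ((~ exists m, inJ J m /\ inJ J (m + 1)%R /\ a m < t <= a (m + 1)%R) /\
   ((J = JZminus /\ n = 0%R /\ a 0%R < t) \/
    (J = JZplus /\ n = (-1)%R /\ t <= a 0%R))).

Definition n0 (R : realType) (J : index_kind) (a : int -> R) (t : R) : int :=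
  xget 0%R [set n | n0_spec J a t n].

Definition In_t (R : realType) (J : index_kind) (a : int -> R) (t : R) (n : int) : set R :=
  if n == n0 J a t then [set` `[0, 2 * aJ J a n - t]]
  else if inJ J n && (n0 J a t < n)%R then [set` `]a n - t, a n]]
  else set0.

(* Complex-valued functions on R; only their restriction to R_+ = [0,oo)
   matters. *)
Notation cfun R := (R -> R[i]).

Definition Va (R : realType) (J : index_kind) (a : int -> R) (t : R)
    (f : cfun R) : cfun R :=
  fun x =>
    if (0 < t) && `[< exists n, In_t J a t n x >] then
      let n := xget 0%R [set n | In_t J a t n x] in
      f (2 * aJ J a n - x - t)
    else 0.

Definition Rshift (R : realType) (t : R) (f : cfun R) : cfun R :=
  fun x => if 0 <= x - t then f (x - t) else 0.
Definition Lshift (R : realType) (t : R) (f : cfun R) : cfun R :=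
  fun x => f (x + t).

Definition Hsp (R : realType) := (cfun R * cfun R)%type.

Definition Ta (R : realType) (J : index_kind) (a : int -> R) (t : R)
    (h : Hsp R) : Hsp R :=
  (fun x => Lshift t h.1 x + Va J a t h.2 x, Rshift t h.2).

(* L^2 structure (up to a.e. equality, handled through the seminorm).       *)
Definition csq (R : realType) (z : R[i]) : R := (complex.Re z) ^+ 2 + (complex.Im z) ^+ 2.

Definition nrm2 (R : realType) (f : cfun R) : \bar R :=
  (\int[@lebesgue_measure R]_(x in `[0%R, +oo[) (csq (f x))%:E)%E.

Definition inL2 (R : realType) (f : cfun R) : Prop :=
  measurable_fun (`[0%R, +oo[ : set R) (fun x => complex.Re (f x)) /\
  measurable_fun (`[0%R, +oo[ : set R) (fun x => complex.Im (f x)) /\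
  (nrm2 f < +oo)%E.

Definition inH (R : realType) (h : Hsp R) : Prop := inL2 h.1 /\ inL2 h.2.

Definition nrmH (R : realType) (h : Hsp R) : \bar R := (nrm2 h.1 + nrm2 h.2)%E.

Definition Hadd (R : realType) (h k : Hsp R) : Hsp R :=
  (fun x => h.1 x + k.1 x, fun x => h.2 x + k.2 x).
Definition Hscale (R : realType) (c : R[i]) (h : Hsp R) : Hsp R :=
  (fun x => c * h.1 x, fun x => c * h.2 x).
Definition Hsub (R : realType) (h k : Hsp R) : Hsp R :=
  (fun x => h.1 x - k.1 x, fun x => h.2 x - k.2 x).

Definition bounded_op (R : realType) (S : Hsp R -> Hsp R) : Prop :=
  (forall h, inH h -> inH (S h)) /\
  (forall (c : R[i]) h k, inH h -> inH k ->
      nrmH (Hsub (S (Hadd (Hscale c h) k)) (Hadd (Hscale c (S h)) (S k))) = 0%E) /\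
  (exists C : R, forall h, inH h -> (nrmH (S h) <= C%:E * nrmH h)%E).

Definition bounded_invertible (R : realType) (S S' : Hsp R -> Hsp R) : Prop :=
  bounded_op S /\ bounded_op S' /\
  (forall h, inH h -> nrmH (Hsub (S (S' h)) h) = 0%E) /\
  (forall h, inH h -> nrmH (Hsub (S' (S h)) h) = 0%E).

Definition similar_to_contraction (R : realType) (T : Hsp R -> Hsp R) : Prop :=
  exists S S' : Hsp R -> Hsp R, bounded_invertible S S' /\
    forall h, inH h -> (nrmH (S (T (S' h))) <= nrmH h)%E.

(* The semigroup (T t)_{t>=0} is similar to a quasi-contraction semigroup:
   ||S T(t) S^{-1}|| <= e^{lambda t}  (stated with squared norms). *)
Definition similar_to_quasi_contraction_sg (R : realType)
    (T : R -> Hsp R -> Hsp R) : Prop :=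
  exists (S S' : Hsp R -> Hsp R) (lambda : R), bounded_invertible S S' /\
    forall t, 0 <= t -> forall h, inH h ->
      (nrmH (S (T t (S' h))) <= (expR (lambda * t) ^+ 2)%:E * nrmH h)%E.

(* Main.v *)
(* For x >= 0 and t > 0, V(t) f (x) = f (2 a_n - t - x) on pairwise disjoint
   intervals, one for each n, which makes V(t) a sum of reflections.

   Sufficiency comes from diagonal similarities: with weights p and q on the two
   components, the weighted square norm of T(t) (f, g) is at most K times that
   of (f, g) as soon as p (x) <= K p (x + t), q (y + t) <= K q (y) and
   2 p (x) + q (y + t) <= K q (y), 2 p (x) <= K p (x + t) when V(t) reflects y
   to x. For J = Z_- monotone weights do this with K = 1; for J = Z_+ weights
   which jump at each a_n and relax in between give K = 1 + O(t).

   Necessity: let N be the square norm for which T is a (quasi-)contraction, let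
   x = (1_[0,B), 0), z = (0, 1_[0,B)), and take times tau_k close to 2 a_(n+k) - B.
   Then T(tau_k) z = x + r_k, where the r_k are nearly orthogonal shifts of z, and
   T(tau_(k+1) - tau_k) kills x, so that N (x + r_(k+1)) <= (1 + 1/M) N (r_k).
   Summing over k < M forces M N (x) to stay bounded. A fixed time step needs large
   a_n (J <> Z_-); small total time needs small a_n (J <> Z_+). *)

Require Import Defs.
From HB Require Import structures.
From mathcomp Require Import all_boot all_order all_algebra.
From mathcomp Require Import all_classical all_reals all_analysis.
From mathcomp Require Import measurable_realfun complex.
From mathcomp Require Import ring lra zify.
Import Order.TTheory GRing.Theory Num.Theory.
Import numFieldNormedType.Exports.
Set Implicit Arguments.
Unset Strict Implicit.
Unset Printing Implicit Defensive.
Local Open Scope classical_set_scope.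
Local Open Scope ring_scope.

(** * Change of variable *)

Local Notation mu := (@lebesgue_measure _).

Section change_of_variable.
Context {R : realType}.

(** Lebesgue measure is determined by its values on the intervals []a, b]], so only the lengths of
    their preimages have to be compared. *)
Lemma pushforward_lebesgue_shift (t : R) (A : set R) : measurable A ->
  pushforward mu ((fun x => x + t) : _ -> measurableTypeR R) A = mu A.
Proof.
have mt : measurable_fun setT ((fun x => x + t) : measurableTypeR R -> measurableTypeR R).
  exact: measurable_funD.
move=> mA; apply/esym.
pose phi := HB.pack_for {mfun measurableTypeR R >-> measurableTypeR R}
  ((fun x => x + t) : measurableTypeR R -> measurableTypeR R)
  (isMeasurableFun.Build _ _ _ _ _ mt).
apply: (@lebesgue_measure_unique R (pushforward mu phi)) => //= _ [[a b]] _ <-.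
rewrite /pushforward.
have -> : phi @^-1` [set` `]a, b]] = [set` `](a - t), (b - t)]].
  by apply/seteqP; split => x; rewrite /= !in_itv/= /phi/= => /andP[? ?]; apply/andP; split; lra.
rewrite !lebesgue_measure_itv/= !lte_fin ltrD2r; case: ifP => // _.
by rewrite -!EFinD; congr EFin; lra.
Qed.

Lemma pushforward_lebesgue_reflect (c : R) (A : set R) : measurable A ->
  pushforward mu ((fun x => c - x) : _ -> measurableTypeR R) A = mu A.
Proof.
have mt : measurable_fun setT ((fun x => c - x) : measurableTypeR R -> measurableTypeR R).
  exact: measurable_funB.
move=> mA; apply/esym.
pose phi := HB.pack_for {mfun measurableTypeR R >-> measurableTypeR R}
  ((fun x => c - x) : measurableTypeR R -> measurableTypeR R)
  (isMeasurableFun.Build _ _ _ _ _ mt).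
apply: (@lebesgue_measure_unique R (pushforward mu phi)) => //= _ [[a b]] _ <-.
rewrite /pushforward.
have -> : phi @^-1` [set` `]a, b]] = [set` `[(c - b), (c - a)[].
  by apply/seteqP; split => x; rewrite /= !in_itv/= /phi/= => /andP[? ?]; apply/andP; split; lra.
rewrite !lebesgue_measure_itv/= !lte_fin ltrD2l ltrN2; case: ifP => // _.
by rewrite -!EFinD; congr EFin; lra.
Qed.

Lemma ge0_integral_measure_preserving (phi : R -> R) (D : set R) (f : R -> \bar R) :
  measurable_fun setT phi ->
  (forall A : set R, measurable A ->
    pushforward mu (phi : _ -> measurableTypeR R) A = mu A) ->
  measurable D -> measurable_fun D f -> (forall y, D y -> (0 <= f y)%E) ->
  (\int[mu]_(x in phi @^-1` D) f (phi x) = \int[mu]_(y in D) f y)%E.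
Proof.
move=> mphi phimu mD mf f0.
rewrite -(@ge0_integral_pushforward _ _ (measurableTypeR R) (measurableTypeR R) R phi mphi mu D f)//; last first.
  by move=> y /set_mem; exact: f0.
by apply: eq_measure_integral => //= A mA AS; exact: phimu.
Qed.

Lemma ge0_integral_shift (t : R) (D : set R) (f : R -> \bar R) :
  measurable D -> measurable_fun D f -> (forall y, D y -> (0 <= f y)%E) ->
  (\int[mu]_(x in (fun x => x + t)%R @^-1` D) f (x + t)%R = \int[mu]_(y in D) f y)%E.
Proof.
apply: ge0_integral_measure_preserving; first exact: measurable_funD.
exact: pushforward_lebesgue_shift.
Qed.

Lemma ge0_integral_reflect (c : R) (D : set R) (f : R -> \bar R) :
  measurable D -> measurable_fun D f -> (forall y, D y -> (0 <= f y)%E) ->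
  (\int[mu]_(x in (fun x => c - x)%R @^-1` D) f (c - x)%R = \int[mu]_(y in D) f y)%E.
Proof.
apply: ge0_integral_measure_preserving; first exact: measurable_funB.
exact: pushforward_lebesgue_reflect.
Qed.

End change_of_variable.

(** * The reflection domains *)

Section lacunary_sequence.
Context {R : realType} (J : index_kind) (a : int -> R).
Hypothesis adm : admissible_seq J a.

Lemma adm_gt0 n : inJ J n -> 0 < a n.
Proof. by case: adm => + _; apply. Qed.

Lemma adm_lt m n : inJ J m -> inJ J n -> m < n -> a m < a n.
Proof. by case: adm => _ [+ _]; apply. Qed.

Lemma adm_le m n : inJ J m -> inJ J n -> m <= n -> a m <= a n.
Proof.
move=> Jm Jn; rewrite le_eqVlt => /predU1P[->//|mn].
by rewrite ltW// adm_lt.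
Qed.

(** Admissibility doubles between neighbours only, in a form depending on [J]; monotonicity carries
    this to all pairs and removes the case distinction. *)
Lemma adm_double m n : inJ J m -> inJ J n -> m < n -> 2 * a m <= a n.
Proof.
move=> Jm Jn mn; case: (adm) => _ [_].
case EJ : J => H; move: (Jm) (Jn); rewrite EJ /= => Jm' Jn'.
- by apply: (le_trans (H _ _)) => //; apply: adm_le; rewrite ?EJ//; lia.
- by apply: (le_trans (H _ _)) => //; apply: adm_le; rewrite ?EJ//=; lia.
- by apply: le_trans (H _ _) => //; rewrite ler_pM2l//; apply: adm_le; rewrite ?EJ//=; lia.
Qed.

(** Doubling adds at least [a 0] at each step, so [a k] grows at least linearly, which gives an
    explicit index. *)
Lemma adm_unbounded (t : R) : J <> JZminus -> exists2 k : int, 0 <= k & t <= a k.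
Proof.
move=> JN.
have J0 k : 0 <= k -> inJ J k by move=> k0; case: (J) JN => //=.
have H (k : nat) : k%:R * a 0 <= a k%:Z.
  elim: k => [|k IH]; first by rewrite mul0r ltW// adm_gt0// J0.
  have d : 2 * a k <= a k.+1 by apply: adm_double; rewrite ?J0//; lia.
  have l : a 0 <= a k%:Z by apply: adm_le; rewrite ?J0//; lia.
  by rewrite -natr1; lra.
have a0 : 0 < a 0 by rewrite adm_gt0// J0.
exists (Num.trunc (t / a 0)).+1%:Z => //.
apply: le_trans (H _); rewrite -ler_pdivrMr// ltW//.
exact: truncnS_gt.
Qed.

(** Downwards, doubling gives [k%:R * a (- k%:Z) <= a 0], so the terms become arbitrarily small. *)
Lemma adm_vanishing (t : R) : J <> JZplus -> 0 < t -> exists2 k : int, k <= 0 & a k < t.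
Proof.
move=> JN t0.
have J0 k : k <= 0 -> inJ J k by move=> k0; case: (J) JN => //=.
have H (k : nat) : k%:R * a (- k%:Z) <= a 0.
  elim: k => [|k IH]; first by rewrite mul0r ltW// adm_gt0// J0.
  have d : 2 * a (- k.+1%:Z) <= a (- k%:Z) by apply: adm_double; rewrite ?J0//; lia.
  have p : 0 < a (- k.+1%:Z) by rewrite adm_gt0// J0//; lia.
  have [->|k0] := eqVneq k 0%N; first by rewrite mul1r; apply: adm_le; rewrite ?J0//; lia.
  have k1 : 1 <= k%:R :> R by rewrite ler1n lt0n.
  have : k%:R * (2 * a (- k.+1%:Z)) <= k%:R * a (- k%:Z) by rewrite ler_wpM2l.
  have : a (- k.+1%:Z) <= k%:R * a (- k.+1%:Z) by rewrite ler_peMl// ltW.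
  by rewrite -[k.+1%:R]natr1; lra.
have a0 : 0 < a 0 by rewrite adm_gt0// J0.
exists (- (Num.trunc (a 0 / t)).+1%:Z) => //.
have := H (Num.trunc (a 0 / t)).+1.
have := truncnS_gt (a 0 / t).
set k := _.+1; rewrite ltr_pdivrMr// => h1 h2.
by have : k%:R * a (- k%:Z) < k%:R * t by [exact: le_lt_trans h1]; rewrite ltr_pM2l.
Qed.

Lemma int_crossing (P : int -> Prop) (m : int) (d : nat) :
  P m -> ~ P (m + d%:Z) -> exists n, [/\ m <= n, n < m + d%:Z, P n & ~ P (n + 1)].
Proof.
elim: d => [|d IH] Pm Pd; first by rewrite addr0 in Pd.
have [Pd'|Pd'] := pselect (P (m + d%:Z)).
  exists (m + d%:Z); split => //; [lia|lia|].
  by rewrite -addrA -[1]/(1%:Z) -PoszD addn1.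
by have [n [? ? ? ?]] := IH Pm Pd'; exists n; split => //; lia.
Qed.

Lemma n0_spec_ex (t : R) : 0 < t -> exists n, n0_spec J a t n.
Proof.
move=> t0.
have [|E] := pselect (exists m, inJ J m /\ inJ J (m + 1)%R /\ a m < t <= a (m + 1)%R).
  by move=> [n ?]; exists n; left.
(* If [t] lay between two terms, the crossing index would contradict [E]. Hence [t] is above all
   terms or below all of them, and the kind of [J] decides which. *)
have C m p : inJ J m -> inJ J p -> m <= p -> a m < t -> t <= a p -> False.
  move=> Jm Jp mp am ap; apply: E.
  have := @int_crossing (fun n => a n < t) m (`|p - m|)%N am.
  have -> : m + `|p - m|%N = p by lia.
  move=> /(_ _)[|n [mn np an /negP an1]]; first by apply/negP; rewrite -leNgt.
  exists n; split; first by move: Jm Jp; case: (J) => //=; lia.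
  split; first by move: Jm Jp; case: (J) => //=; lia.
  by rewrite an leNgt.
case EJ : J.
- have [k k0 ak] : exists2 k : int, 0 <= k & t <= a k by apply: adm_unbounded; rewrite EJ.
  have [m m0 am] : exists2 k : int, k <= 0 & a k < t by apply: adm_vanishing; rewrite ?EJ.
  by case: (C m k); rewrite ?EJ//; lia.
- exists (-1); right; split; first by rewrite -EJ.
  right; split => //; split => //; rewrite leNgt; apply/negP => a0.
  have [k k0 ak] : exists2 k : int, 0 <= k & t <= a k by apply: adm_unbounded; rewrite EJ.
  by case: (C 0 k); rewrite ?EJ.
- exists 0; right; split; first by rewrite -EJ.
  left; split => //; split => //; rewrite ltNge; apply/negP => a0.
  have [m m0 am] : exists2 k : int, k <= 0 & a k < t by apply: adm_vanishing; rewrite ?EJ.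
  by case: (C m 0); rewrite ?EJ.
Qed.

(** A single formula for all I_n(t). For n > n0, [t <= a n] makes the bounds [a n - t] and [a n] the
    binding ones; for n = n0, [a n < t] makes 0 and [2 * a n - t] binding; for n < n0, [2 * a n < t]
    leaves the empty set. *)
Definition refl_dom (t : R) (n : int) : set R :=
  [set x | [/\ inJ J n, 0 <= x, a n - t < x, x <= a n & x <= 2 * a n - t]].

(** For m < n, doubling puts the right end [2 * a m - t] at or below the excluded left end
    [a n - t]. *)
Lemma refl_dom_inj (t x : R) m n : refl_dom t m x -> refl_dom t n x -> m = n.
Proof.
wlog mn : m n / m <= n.
  by move=> H Dm Dn; have [/H|/ltW/H H'] := leP m n; [exact|exact/esym/H'].
move=> [Jm x0 xm1 xm2 xm3] [Jn _ xn1 xn2 xn3]; apply/eqP; rewrite eq_le mn /= leNgt.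
apply/negP => mn'; have := adm_double Jm Jn mn'; lra.
Qed.

Lemma In_tE (t x : R) n : 0 < t -> 0 <= x ->
  In_t J a t n x <-> refl_dom t n x.
Proof.
move=> t0 x0; rewrite /In_t /n0.
have := n0_spec_ex t0; case: xgetP => [p _ pE _|]; last by move=> H [p /H].
have {}pE : n0_spec J a t p := pE.
have small m : inJ J m -> m < p -> 2 * a m < t.
  move=> Jm mp; case: pE => [[Jp [_ /andP[ap _]]]|[_]].
    by apply: le_lt_trans ap; exact: adm_double.
  move=> [[EJ [pE ap]]|[EJ [pE ap]]].
    by apply: le_lt_trans ap; apply: adm_double; rewrite -?pE// EJ pE.
  by move: Jm; rewrite EJ /=; lia.
have large m : inJ J m -> p < m -> t <= a m.
  move=> Jm mp; case: pE => [[Jp [Jp1 /andP[_ ap]]]|[_]].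
    by apply: le_trans ap _; apply: adm_le => //; lia.
  move=> [[EJ [pE ap]]|[EJ [pE ap]]].
    by move: Jm; rewrite EJ /=; lia.
  by apply: le_trans ap _; apply: adm_le; rewrite ?EJ//=; lia.
have ltp : inJ J p -> a p < t.
  move=> Jp; case: pE => [[_ [_ /andP[ap _]]]//|[_]].
  move=> [[EJ [pE ap]]|[EJ [pE ap]]]; first by rewrite pE.
  by move: Jp; rewrite EJ pE.
rewrite /aJ; case: eqVneq => [->|np].
  case: ifPn => Jp; rewrite /= in_itv/=.
    have := ltp Jp; split; first by move=> /andP[? ?]; split => //; lra.
    by case=> *; apply/andP; split => //; lra.
  (* Here the index is -1 and [aJ] is 0, so the interval of [In_t] is [[0, - t]], which is empty. *)
  by split; [move=> /andP[]; lra|case; rewrite (negbTE Jp)].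
case: ifPn => [/andP[Jn pn]|Jpn].
  have ln := large _ Jn pn; have an := adm_gt0 Jn; rewrite /= in_itv/=.
  by split; [move=> /andP[? ?]; split => //; lra|case=> *; apply/andP; split].
split => // -[Jn _ _ _ ?]; move: Jpn; rewrite Jn /= -leNgt => pn.
have nlp : n < p by rewrite lt_neqAle np.
by have := small _ Jn nlp; lra.
Qed.

Lemma Va_in (t x : R) n f : 0 < t -> refl_dom t n x ->
  Va J a t f x = f (2 * a n - t - x).
Proof.
move=> t0 Dx; have x0 : 0 <= x by case: Dx.
rewrite /Va t0 /=; case: asboolP => [|[]]; last by exists n; apply/In_tE.
move=> _; case: xgetP => [m _ /(In_tE _ t0 x0) Dm|/(_ n)]; last by case; apply/In_tE.
rewrite (refl_dom_inj Dm Dx) /aJ; have [-> _ _ _ _] := Dx.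
by congr f; lra.
Qed.

Lemma Va_out (t x : R) f : 0 < t -> 0 <= x -> (forall n, ~ refl_dom t n x) ->
  Va J a t f x = 0.
Proof.
move=> t0 x0 H; rewrite /Va t0 /=; case: asboolP => // -[n /(In_tE _ t0 x0)].
by move/H.
Qed.

Lemma Va_le0 (t : R) f x : t <= 0 -> Va J a t f x = 0.
Proof. by move=> t0; rewrite /Va ltNge t0. Qed.

End lacunary_sequence.

(** * The reflection as a partial map of the half-line *)

Section reflection.
Context {R : realType} (J : index_kind) (a : int -> R).
Local Notation Rp := ([set` `[0%R, +oo[] : set R).
Hypothesis adm : admissible_seq J a.
Variable t : R.
Hypothesis t0 : 0 < t.

Local Notation dom := (refl_dom J a t).

Definition refl_set : set R := \bigcup_n dom n.
Definition refl (x : R) : R := 2 * a (xget 0 [set n | dom n x]) - t - x.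

Lemma reflE n x : dom n x -> refl x = 2 * a n - t - x.
Proof.
move=> Dx; rewrite /refl; case: xgetP => [m _ Dm|/(_ n)//].
by rewrite (refl_dom_inj adm Dm Dx).
Qed.

Lemma refl_ge0 x : refl_set x -> 0 <= refl x.
Proof. by move=> [n _ Dx]; rewrite (reflE Dx); case: Dx; lra. Qed.

Lemma VaE f x : 0 <= x -> Va J a t f x = if x \in refl_set then f (refl x) else 0.
Proof.
move=> x0; case: ifPn => [/set_mem[n _ Dx]|/negP xD].
  by rewrite (Va_in adm _ t0 Dx) (reflE Dx).
by rewrite (Va_out adm)// => n Dx; apply: xD; apply/mem_set; exists n.
Qed.

Lemma measurable_refl_dom n : measurable (dom n).
Proof.
have [Jn|Jn] := boolP (inJ J n); last first.
  by rewrite (_ : dom n = set0)//; apply/seteqP; split => x //= -[]; rewrite (negbTE Jn).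
rewrite (_ : dom n = [set` `[0, +oo[] `&` [set` `]a n - t, a n]] `&` [set` `]-oo, 2 * a n - t]]).
  by apply: measurableI; [apply: measurableI|]; exact: measurable_itv.
apply/seteqP; split => x /=; rewrite !in_itv/= andbT.
  by case=> ? ? ? ? ?; split => //; split => //; apply/andP.
by case=> -[? /andP[? ?] ?]; split.
Qed.

(* Enumeration of the domains, since the libraries only sum measures over nat. *)
Let domk (k : nat) : set R := if @pickle_inv int k is Some n then dom n else set0.

Let refl_setE : refl_set = \bigcup_k domk k.
Proof.
apply/seteqP; split => x [n _ Dx].
  by exists (pickle n); [exact: I|rewrite /domk pickleK_inv].
by move: Dx; rewrite /domk; case: pickle_inv => // m Dx; exists m.
Qed.

Let measurable_domk k : measurable (domk k).
Proof. by rewrite /domk; case: pickle_inv => [n|//]; exact: measurable_refl_dom. Qed.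

Lemma measurable_refl_set : measurable refl_set.
Proof. by rewrite refl_setE; exact: bigcup_measurable. Qed.

Lemma measurable_comp_refl d (T : measurableType d) (g : R -> T) :
  measurable_fun Rp g -> measurable_fun refl_set (g \o refl).
Proof.
move=> mg; rewrite refl_setE; apply/measurable_fun_bigcup => // k.
rewrite /domk; case: pickle_inv => [n|]; last exact: measurable_fun_set0.
apply: (eq_measurable_fun (g \o (fun x => 2 * a n - t - x))).
  by move=> x /set_mem Dx /=; rewrite (reflE Dx).
apply: (measurable_comp (F := Rp)) => //.
  by move=> _ [x [? ? ? ? ?] <-]; rewrite /= in_itv/= andbT; lra.
exact: measurable_funB.
Qed.

(** On each domain the reflection preserves measure, and the images of distinct domains are disjoint
    by doubling, so the integrals add up to at most the one over the half-line. The origin is left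
    out because, when [a n = 2 * a m], the image of 0 from [dom m] may coincide with that of [a n]
    from [dom n]. *)
Lemma integral_refl_le (F : R -> \bar R) :
  measurable_fun Rp F -> (forall y, Rp y -> (0 <= F y)%E) ->
  (\int[mu]_(x in refl_set `&` [set` `]0%R, +oo[]) F (refl x) <= \int[mu]_(y in Rp) F y)%E.
Proof.
move=> mF F0; pose E k := domk k `&` [set` `]0%R, +oo[].
have mE k : measurable (E k) by apply: measurableI.
pose c k := 2 * a (odflt 0 (@pickle_inv int k)) - t.
(* As a reflection is an involution, this preimage is also the image of [E k]. *)
pose E' k := (fun y => c k - y) @^-1` E k.
have mE' k : measurable (E' k).
  rewrite -[E' k]setTI; have : measurable_fun setT (fun y : R => c k - y).
    exact: measurable_funB.
  by apply.
have domkE k x : domk k x -> exists2 n, @pickle_inv int k = Some n & dom n x.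
  by rewrite /domk; case: pickle_inv => // n ?; exists n.
have E'Rp k : E' k `<=` Rp.
  move=> y [/domkE[n nE]]; rewrite /c nE /= => -[_ ? ? ? ?] _.
  by rewrite in_itv/= andbT; lra.
have inj k l n : @pickle_inv int k = Some n -> @pickle_inv int l = Some n -> k = l.
  move=> nk nl; have := @pickle_invK int k; have := @pickle_invK int l.
  by rewrite nk nl /= => <- <-.
have trivE : trivIset setT E.
  move=> k l _ _ [x [[/domkE[n nk Dn] _] [/domkE[m ml Dm] _]]].
  by apply: (inj _ _ n) => //; rewrite ml (refl_dom_inj adm Dm Dn).
have trivE' : trivIset setT E'.
  move=> k l _ _ [y []]; rewrite /E' /= => -[/domkE[n nk] +] x0 [/domkE[m ml] +] x0'.
  move: x0 x0'; rewrite /c /= nk ml !in_itv/= !andbT => x0 x0' Dn Dm.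
  apply: (inj _ _ n) => //; rewrite ml; congr Some; apply/eqP.
  case: Dn Dm => Jn n1 n2 n3 n4 [Jm m1 m2 m3 m4].
  rewrite eq_le; apply/andP; split; rewrite leNgt; apply/negP => /(adm_double adm).
    by move=> /(_ Jn Jm); lra.
  by move=> /(_ Jm Jn); lra.
rewrite refl_setE setI_bigcupl ge0_integral_bigcup//; last 2 first.
- rewrite -setI_bigcupl -refl_setE.
  apply: (@measurable_funS _ _ _ _ refl_set); first exact: measurable_refl_set.
    exact: subIsetl.
  exact: measurable_comp_refl.
- rewrite -setI_bigcupl -refl_setE => x [/refl_ge0 x0 _]; apply: F0.
  by rewrite /= in_itv/= x0.
have -> : (\sum_(0 <= i <oo) \int[mu]_(x in E i) F (refl x))%E =
   (\sum_(0 <= i <oo) \int[mu]_(x in E' i) F x)%E.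
  apply: eq_eseriesr => k _.
  rewrite -(@ge0_integral_reflect R (c k) (E' k))//; last 2 first.
  - exact: (measurable_funS _ (@E'Rp k) mF).
  - by move=> y /E'Rp; exact: F0.
  have -> : (fun x : R => c k - x) @^-1` E' k = E k.
    by apply/seteqP; split => x; rewrite /E' /= subKr.
  apply: eq_integral => x /set_mem[/domkE[n nE Dx] _].
  by rewrite (reflE Dx) /c nE.
rewrite -ge0_integral_bigcup//; last 2 first.
- apply: (measurable_funS _ _ mF) => //; exact: bigcup_sub.
- by move=> y [k _ /E'Rp]; exact: F0.
apply: ge0_subset_integral => //; first exact: bigcupT_measurable.
by apply: bigcup_sub.
Qed.

End reflection.

(** * Square-integrable functions *)

Section L2_functions.
Context {R : realType}.
Local Notation Rp := ([set` `[0%R, +oo[] : set R).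
Implicit Types (z w : R[i]) (f g : cfun R) (h k : Hsp R).

Lemma csq_ge0 z : 0 <= csq z.
Proof. by rewrite addr_ge0// sqr_ge0. Qed.

Lemma csq0 : csq (0 : R[i]) = 0.
Proof. by rewrite /csq /= expr0n /= addr0. Qed.

Lemma csqD_le z w : csq (z + w) <= 2 * csq z + 2 * csq w.
Proof.
case: z w => [a b] [c d]; rewrite /csq /=.
have := sqr_ge0 (a - c); have := sqr_ge0 (b - d); lra.
Qed.

Lemma csqM z w : csq (z * w) = csq z * csq w.
Proof. by case: z w => [a b] [c d]; rewrite /csq /=; ring. Qed.

Lemma csq_real (r : R) : csq r%:C%C = r ^+ 2.
Proof. by rewrite /csq /= expr0n addr0. Qed.

Lemma csq_eq0 z : csq z = 0 -> z = 0.
Proof.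
case: z => [a b]; rewrite /csq /= => /eqP; rewrite paddr_eq0 ?sqr_ge0//.
by rewrite !sqrf_eq0 => /andP[/eqP-> /eqP->].
Qed.

Definition cmeasurable f :=
  measurable_fun Rp (fun x => complex.Re (f x)) /\
  measurable_fun Rp (fun x => complex.Im (f x)).

Lemma inL2_cmeasurable f : inL2 f -> cmeasurable f.
Proof. by case=> ? []. Qed.

Lemma cmeasurable_csq f : cmeasurable f -> measurable_fun Rp (fun x => csq (f x)).
Proof. by case=> mr mi; apply: measurable_funD; apply: measurable_funX. Qed.

Lemma cmeasurableD f g : cmeasurable f -> cmeasurable g ->
  cmeasurable (fun x => f x + g x).
Proof.
move=> [fr fi] [gr gi]; split.
  rewrite [X in measurable_fun _ X](_ : _ = (fun x => complex.Re (f x)) \+ (fun x => complex.Re (g x))).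
    exact: measurable_funD.
  by apply/funext => x /=; case: (f x) (g x) => [? ?] [].
rewrite [X in measurable_fun _ X](_ : _ = (fun x => complex.Im (f x)) \+ (fun x => complex.Im (g x))).
  exact: measurable_funD.
by apply/funext => x /=; case: (f x) (g x) => [? ?] [].
Qed.

Lemma cmeasurableM (p : R -> R) f : measurable_fun Rp p -> cmeasurable f ->
  cmeasurable (fun x => (p x)%:C%C * f x).
Proof.
move=> mp [fr fi]; split.
  rewrite [X in measurable_fun _ X](_ : _ = p \* (fun x => complex.Re (f x))).
    exact: measurable_funM.
  by apply/funext => x /=; case: (f x) => [? ?] /=; rewrite mul0r subr0.
rewrite [X in measurable_fun _ X](_ : _ = p \* (fun x => complex.Im (f x))).
  exact: measurable_funM.
by apply/funext => x /=; case: (f x) => [? ?] /=; rewrite mul0r addr0.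
Qed.

Lemma cmeasurableZ z f : cmeasurable f -> cmeasurable (fun x => z * f x).
Proof.
move=> [fr fi]; split.
  rewrite [X in measurable_fun _ X](_ : _ = (cst (complex.Re z) \* (fun x => complex.Re (f x)))
    \- (cst (complex.Im z) \* (fun x => complex.Im (f x)))).
    by apply: measurable_funB; apply: measurable_funM.
  by apply/funext => x /=; case: (f x) z => [? ?] [].
rewrite [X in measurable_fun _ X](_ : _ = (cst (complex.Re z) \* (fun x => complex.Im (f x)))
    \+ (cst (complex.Im z) \* (fun x => complex.Re (f x)))).
  by apply: measurable_funD; apply: measurable_funM.
by apply/funext => x /=; case: (f x) z => [? ?] [].
Qed.

Lemma nrm2_ge0 f : (0 <= nrm2 f)%E.
Proof. by apply: integral_ge0 => x _; rewrite lee_fin csq_ge0. Qed.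

Lemma nrm2_le_lin (c : R) f (G : R -> \bar R) : 0 <= c -> cmeasurable f ->
  measurable_fun Rp G -> (forall x, 0 <= x -> ((csq (f x))%:E <= c%:E * G x)%E) ->
  (forall x, 0 <= x -> (0 <= G x)%E) ->
  (nrm2 f <= c%:E * \int[mu]_(x in Rp) G x)%E.
Proof.
have RpE x : Rp x -> 0 <= x by rewrite /= in_itv/= andbT.
move=> c0 mf mG fG G0; rewrite -ge0_integralZl//; last by move=> x /RpE; exact: G0.
apply: ge0_le_integral => //.
- by move=> x _; rewrite lee_fin csq_ge0.
- by apply/measurable_EFinP; apply: cmeasurable_csq.
- exact: measurable_funeM.
- by move=> x /RpE; exact: fG.
Qed.

Lemma inL2_le f g (c : R) : cmeasurable f -> inL2 g -> 0 <= c ->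
  (forall x, 0 <= x -> csq (f x) <= c * csq (g x)) -> inL2 f.
Proof.
move=> mf [mg1 [mg2 gfin]] c0 fg; have [mf1 mf2] := mf; do 2 split => //.
apply: (@le_lt_trans _ _ (c%:E * nrm2 g)%E); last by rewrite lte_mul_pinfty.
apply: nrm2_le_lin => //.
- by apply/measurable_EFinP; apply: cmeasurable_csq.
- by move=> x x0; rewrite lee_fin csq_ge0.
Qed.

Lemma nrm2D_le f g : cmeasurable f -> cmeasurable g ->
  (nrm2 (fun x => f x + g x)%R <= 2%:E * (nrm2 f + nrm2 g))%E.
Proof.
move=> mf mg; rewrite /nrm2 -ge0_integralD//; first apply: nrm2_le_lin => //.
- exact: cmeasurableD.
- by apply: emeasurable_funD; by apply/measurable_EFinP; apply: cmeasurable_csq.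
- by move=> x _; rewrite -EFinD -EFinM lee_fin mulrDr csqD_le.
- by move=> x _; rewrite -EFinD lee_fin addr_ge0// csq_ge0.
- by move=> x _; rewrite lee_fin csq_ge0.
- by apply/measurable_EFinP; apply: cmeasurable_csq.
- by move=> x _; rewrite lee_fin csq_ge0.
- by apply/measurable_EFinP; apply: cmeasurable_csq.
Qed.

Lemma inL2D f g : inL2 f -> inL2 g -> inL2 (fun x => f x + g x).
Proof.
move=> f2 g2; have mf := inL2_cmeasurable f2; have mg := inL2_cmeasurable g2.
have [m1 m2] := cmeasurableD mf mg; do 2 split => //.
apply: le_lt_trans (nrm2D_le mf mg) _; rewrite lte_mul_pinfty// lte_add_pinfty//.
  by case: f2 => ? [].
by case: g2 => ? [].
Qed.

Lemma inL2Z z f : inL2 f -> inL2 (fun x => z * f x).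
Proof.
move=> f2; apply: (inL2_le (c := csq z) _ f2); last by move=> x _; rewrite csqM.
  exact/cmeasurableZ/inL2_cmeasurable.
exact: csq_ge0.
Qed.

Lemma inL2B f g : inL2 f -> inL2 g -> inL2 (fun x => f x - g x).
Proof.
move=> f2 /(inL2Z (-1)) g2; have := inL2D f2 g2.
by under eq_fun do rewrite mulN1r.
Qed.

Lemma inL2_0 : inL2 (fun=> 0 : R[i]).
Proof.
split; first exact: measurable_cst; split; first exact: measurable_cst.
rewrite /nrm2; under eq_integral do rewrite csq0.
by rewrite integral0.
Qed.

Lemma eq_nrm2 f g : (forall x, 0 <= x -> csq (f x) = csq (g x)) -> nrm2 f = nrm2 g.
Proof.
move=> fg; apply: eq_integral => x /set_mem; rewrite /= in_itv/= andbT => x0.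
by rewrite fg.
Qed.

(** Identities between operators hold only up to null functions; they are used through equality of
    norms, since a vanishing integral of [csq] forces equality almost everywhere. *)
Lemma nrm2B0 f g : inL2 f -> inL2 g -> nrm2 (fun x => f x - g x) = 0%E ->
  nrm2 f = nrm2 g.
Proof.
move=> f2 g2 fg0; have d2 := inL2B f2 g2.
have mc (u : cfun R) : inL2 u -> measurable_fun Rp (fun x => (csq (u x))%:E).
  by move=> u2; apply/measurable_EFinP; apply: cmeasurable_csq; exact: inL2_cmeasurable.
apply: ae_eq_integral => //; [exact: mc|exact: mc|].
have : ae_eq mu Rp (fun x => (csq (f x - g x))%:E) (cst 0%E).
  apply/ae_eq_integral_abs => //; first exact: mc.
  rewrite -fg0; apply: eq_integral => x _.
  by rewrite gee0_abs// lee_fin csq_ge0.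
apply: filterS => x /= H xp; have [/csq_eq0/eqP] := H xp.
by rewrite subr_eq0 => /eqP->.
Qed.

Lemma inHD h k : inH h -> inH k -> inH (Hadd h k).
Proof. by case=> ? ? [? ?]; split; exact: inL2D. Qed.

Lemma inHB h k : inH h -> inH k -> inH (Hsub h k).
Proof. by case=> ? ? [? ?]; split; exact: inL2B. Qed.

Lemma nrmH_ge0 h : (0 <= nrmH h)%E.
Proof. by rewrite adde_ge0// nrm2_ge0. Qed.

Lemma nrmH_fin h : inH h -> nrmH h \is a fin_num.
Proof.
move=> [[_ [_ h1]] [_ [_ h2]]]; rewrite fin_numD !ge0_fin_numE ?nrm2_ge0//.
by rewrite h1 h2.
Qed.

Lemma nrmHB0 h k : inH h -> inH k -> nrmH (Hsub h k) = 0%E -> nrmH h = nrmH k.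
Proof.
move=> [h1 h2] [k1 k2] /eqP; rewrite padde_eq0 ?nrm2_ge0// => /andP[/eqP E1 /eqP E2].
by rewrite /nrmH (nrm2B0 h1 k1 E1) (nrm2B0 h2 k2 E2).
Qed.

Lemma nrmHD_le h k : inH h -> inH k ->
  (nrmH (Hadd h k) <= 2%:E * (nrmH h + nrmH k))%E.
Proof.
move=> [/inL2_cmeasurable h1 /inL2_cmeasurable h2] [/inL2_cmeasurable k1 /inL2_cmeasurable k2].
rewrite [nrmH h]/nrmH [nrmH k]/nrmH addeACA muleDr//; last by rewrite ge0_adde_def// inE adde_ge0// nrm2_ge0.
exact: (leeD (nrm2D_le h1 k1) (nrm2D_le h2 k2)).
Qed.

Lemma eq_nrmH h k : (forall x, 0 <= x -> h.1 x = k.1 x /\ h.2 x = k.2 x) -> nrmH h = nrmH k.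
Proof. by move=> hk; congr (_ + _)%E; apply: eq_nrm2 => x /hk[E1 E2]; rewrite ?E1 ?E2. Qed.

End L2_functions.

(** * The weighted estimate *)

Section weighted_estimate.
Context {R : realType} (J : index_kind) (a : int -> R).
Local Notation Rp := ([set` `[0%R, +oo[] : set R).
Hypothesis adm : admissible_seq J a.
Variable t : R.
Hypothesis t0 : 0 < t.
Implicit Types (f g : cfun R) (h k : Hsp R) (p q : R -> R).

Let RpE x : Rp x = (0 <= x) :> Prop.
Proof. by rewrite /= in_itv/= andbT. Qed.

Lemma measurable_shift d (T : measurableType d) (u : R -> T) :
  measurable_fun Rp u -> measurable_fun Rp (fun x => u (x + t)).
Proof.
move=> mu_; apply: (measurable_comp (F := Rp)) => //.
  by move=> _ [x + <-]; rewrite !RpE => x0; rewrite addr_ge0// ltW.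
exact: measurable_funD.
Qed.

Lemma cmeasurable_Lshift f : cmeasurable f -> cmeasurable (Lshift t f).
Proof.
move=> [fr fi]; split.
  exact: (@measurable_shift _ _ (fun x => complex.Re (f x))).
exact: (@measurable_shift _ _ (fun x => complex.Im (f x))).
Qed.

Lemma cmeasurable_Rshift f : cmeasurable f -> cmeasurable (Rshift t f).
Proof.
have H (u : R -> R) : measurable_fun Rp u ->
    measurable_fun Rp ((fun x => u (x - t)) \_ [set` `[t, +oo[]).
  move=> mf; apply/measurable_restrict => //.
  apply: (measurable_comp (F := Rp)) => //.
    by move=> _ [x [_ +] <-]; rewrite RpE /= in_itv/= andbT subr_ge0.
  exact: measurable_funD.
move=> [/H fr /H fi]; split; [move: fr|move: fi];
  apply: eq_measurable_fun => x _; rewrite patchE /Rshift mem_setE in_itv/= andbT subr_ge0;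
  by case: ifP.
Qed.

Lemma measurable_refl_patch (u : R -> R) : measurable_fun Rp u ->
  measurable_fun Rp ((u \o refl J a t) \_ (refl_set J a t)).
Proof.
move=> mf; apply/measurable_restrict => //; first exact: measurable_refl_set.
apply: (measurable_funS (measurable_refl_set J a t)); first exact: subIsetr.
exact: measurable_comp_refl.
Qed.

Lemma cmeasurable_Va f : cmeasurable f -> cmeasurable (Va J a t f).
Proof.
move=> [/measurable_refl_patch fr /measurable_refl_patch fi]; split; [move: fr|move: fi];
  apply: eq_measurable_fun => x /set_mem; rewrite RpE => x0; rewrite patchE VaE//=;
  by case: ifP.
Qed.

Definition wnrm2 p f : \bar R := (\int[mu]_(x in Rp) (p x * csq (f x))%:E)%E.

Lemma measurable_wcsq p f : measurable_fun Rp p -> cmeasurable f ->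
  measurable_fun Rp (fun x => p x * csq (f x)).
Proof. by move=> mp /cmeasurable_csq mf; exact: measurable_funM. Qed.

Section weights.
Variables (p q : R -> R) (K : R).
Hypotheses (mp : measurable_fun Rp p) (mq : measurable_fun Rp q).
Hypotheses (p0 : forall x, 0 <= x -> 0 <= p x) (q0 : forall x, 0 <= x -> 0 <= q x).
Hypothesis K0 : 0 <= K.
Hypothesis p_shift : forall x, 0 <= x -> p x <= K * p (x + t).
Hypothesis q_shift : forall y, 0 <= y -> q (y + t) <= K * q y.
Hypothesis pq_refl : forall n x, refl_dom J a t n x ->
  2 * p x <= K * p (x + t) /\ 2 * p x + q (2 * a n - x) <= K * q (2 * a n - t - x).

(** The slack of the second component: [K] times its old weighted density, minus the density after
    the right shift. It pays for the mass that V(t) sends to the first component. *)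
Let F g y := (K * q y - q (y + t)) * csq (g y).

Let F_ge0 g y : 0 <= y -> 0 <= F g y.
Proof. by move=> y0; rewrite mulr_ge0 ?csq_ge0// subr_ge0 q_shift. Qed.

Let mF g : cmeasurable g -> measurable_fun Rp (F g).
Proof.
move=> mg; apply: measurable_funM; last exact: cmeasurable_csq.
apply: measurable_funB; last exact: measurable_shift.
exact: measurable_funM.
Qed.

Let G g := (F g \o refl J a t) \_ (refl_set J a t).

Let G_ge0 g x : 0 <= G g x.
Proof.
rewrite /G patchE; case: ifPn => // /set_mem xU.
by apply: F_ge0; exact: refl_ge0.
Qed.

Let integral_G g : cmeasurable g ->
  (\int[mu]_(x in Rp) (G g x)%:E <= \int[mu]_(x in Rp) (F g x)%:E)%E.
Proof.
move=> mg; rewrite -integral_itv_obnd_cbnd; last first.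
  apply: (@measurable_funS _ _ _ _ Rp) => //.
    by move=> x /=; rewrite !in_itv/= !andbT => /ltW.
  by apply/measurable_EFinP; apply: measurable_refl_patch; exact: mF.
have -> : (\int[mu]_(x in [set` `]0%R, +oo[]) (G g x)%:E =
    \int[mu]_(x in refl_set J a t `&` [set` `]0%R, +oo[]) (F g (refl J a t x))%:E)%E.
  rewrite setIC integral_mkcondr; apply: eq_integral => x _.
  by rewrite /G !patchE; case: ifP.
apply: (@integral_refl_le _ _ _ adm t (EFin \o F g)); first by apply/measurable_EFinP; exact: mF.
by move=> y /=; rewrite in_itv/= andbT lee_fin; exact: F_ge0.
Qed.

Let pointwise f g x : 0 <= x ->
  p x * csq (Lshift t f x + Va J a t g x) <= K * (p (x + t) * csq (f (x + t))) + G g x.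
Proof.
move=> x0; rewrite /Lshift VaE// /G patchE; case: ifPn => [/set_mem xU|_]; last first.
  by rewrite !addr0 mulrA ler_wpM2r ?csq_ge0 ?p_shift.
have [n _ Dx] := xU; have [H1 H2] := pq_refl Dx.
(* The right shift moves the mass at the reflected point y to y + t, which is where [pq_refl]
   evaluates [q]. *)
have yt : refl J a t x + t = 2 * a n - x by rewrite (reflE adm Dx); lra.
rewrite /F /= yt; move: H1 H2; rewrite -(reflE adm Dx).
set y := refl J a t x => H1 H2.
(* Splitting the square of the sum costs the factors 2 that occur in [pq_refl]. *)
apply: (@le_trans _ _ (p x * (2 * csq (f (x + t)) + 2 * csq (g y)))).
  by rewrite ler_wpM2l ?p0// csqD_le.
have := @ler_wpM2r _ _ (csq_ge0 (f (x + t))) _ _ H1.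
have := @ler_wpM2r _ _ (csq_ge0 (g y)) (2 * p x) (K * q y - q (2 * a n - x)).
by move=> /(_ _)/[!lerBrDr]/(_ H2); lra.
Qed.

Lemma weighted_Ta_le h : inH h ->
  (wnrm2 p (Ta J a t h).1 + wnrm2 q (Ta J a t h).2 <=
   K%:E * (wnrm2 p h.1 + wnrm2 q h.2))%E.
Proof.
move=> [/inL2_cmeasurable m1 /inL2_cmeasurable m2].
have ge x : Rp x -> 0 <= x by rewrite RpE.
have mp1 : measurable_fun Rp (fun x => p (x + t) * csq (h.1 (x + t))).
  exact: (measurable_shift (measurable_wcsq mp m1)).
have first_part : (wnrm2 p (Ta J a t h).1 <=
    K%:E * wnrm2 p h.1 + \int[mu]_(x in Rp) (F h.2 x)%:E)%E.
  apply: (@le_trans _ _ (\int[mu]_(x in Rp)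
      (K%:E * (p (x + t) * csq (h.1 (x + t)))%:E + (G h.2 x)%:E))%E).
    apply: ge0_le_integral => //.
    - by move=> x /ge x0; rewrite lee_fin mulr_ge0 ?p0 ?csq_ge0.
    - apply/measurable_EFinP; apply: measurable_wcsq => //.
      by apply: cmeasurableD; [exact: cmeasurable_Lshift|exact: cmeasurable_Va].
    - apply: emeasurable_funD; last first.
        by apply/measurable_EFinP; apply: measurable_refl_patch; exact: mF.
      by apply: measurable_funeM; exact/measurable_EFinP.
    - by move=> x /ge x0; rewrite -EFinM -EFinD lee_fin pointwise.
  rewrite ge0_integralD//; last 4 first.
  - by move=> x /ge x0; rewrite -EFinM lee_fin !mulr_ge0 ?csq_ge0 ?p0// addr_ge0// ltW.
  - by apply: measurable_funeM; exact/measurable_EFinP.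
  - by move=> x _; rewrite lee_fin.
  - by apply/measurable_EFinP; apply: measurable_refl_patch; exact: mF.
  apply: leeD; last exact: integral_G.
  rewrite ge0_integralZl//; last 2 first.
  - exact/measurable_EFinP.
  - by move=> x /ge x0; rewrite lee_fin !mulr_ge0 ?csq_ge0 ?p0// addr_ge0// ltW.
  apply: lee_wpmul2l => //.
  (* The left shift sees only the part of [h.1] on [[t, +oo[]; the integral is then enlarged to the
     whole half-line. *)
  have := @ge0_integral_shift R t [set` `[t, +oo[] (fun y => (p y * csq (h.1 y))%:E).
  have sub : [set` `[t, +oo[] `<=` Rp.
    by move=> x /=; rewrite !in_itv/= !andbT; exact/le_trans/ltW.
  have -> : (fun x : R => x + t) @^-1` [set` `[t, +oo[] = Rp.
    by apply/seteqP; split => x /=; rewrite !in_itv/= !andbT ?lerDr ?subr_ge0.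
  move=> /(_ _ _ _)->//; last 2 first.
  - apply: (measurable_funS _ sub) => //.
    by apply/measurable_EFinP; exact: measurable_wcsq.
  - by move=> y /sub/ge y0; rewrite lee_fin !mulr_ge0 ?csq_ge0 ?p0.
  apply: ge0_subset_integral => //.
  - by apply/measurable_EFinP; exact: measurable_wcsq.
  - by move=> y /ge y0; rewrite lee_fin !mulr_ge0 ?csq_ge0 ?p0.
have second_part : wnrm2 q (Ta J a t h).2 =
    (\int[mu]_(y in Rp) (q (y + t) * csq (h.2 y))%:E)%E.
  have := @ge0_integral_shift R (- t) Rp (fun y => (q (y + t) * csq (h.2 y))%:E).
  have -> : (fun x : R => x + - t) @^-1` Rp = [set` `[t, +oo[].
    by apply/seteqP; split => x /=; rewrite !in_itv/= !andbT ?lerDr ?subr_ge0.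
  move=> /(_ _ _ _)<-//; last 2 first.
  - apply/measurable_EFinP; apply: measurable_funM; last exact: cmeasurable_csq.
    exact: measurable_shift.
  - by move=> y /ge y0; rewrite lee_fin !mulr_ge0 ?csq_ge0 ?q0// addr_ge0// ltW.
  rewrite /wnrm2 integral_mkcond [RHS]integral_mkcond; apply: eq_integral => x _.
  rewrite !patchE !mem_setE !in_itv/= !andbT /Rshift subr_ge0 subrK.
  case: (leP t x) => tx; first by rewrite (le_trans (ltW t0) tx).
  by case: ifP; rewrite // csq0 mulr0.
rewrite second_part muleDr//; last first.
  by rewrite ge0_adde_def// inE; apply: integral_ge0 => x /ge x0; rewrite lee_fin mulr_ge0 ?csq_ge0 ?p0 ?q0.
(* The slack [F] and the shifted density of the second component add up to exactly
   [K * (q x * csq (h.2 x))]. *)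
apply: (le_trans (leeD2r _ first_part)); rewrite -addeA; apply: leeD => //.
rewrite -ge0_integralD//; last 4 first.
- by move=> x /ge x0; rewrite lee_fin F_ge0.
- by apply/measurable_EFinP; exact: mF.
- by move=> y /ge y0; rewrite lee_fin !mulr_ge0 ?csq_ge0 ?q0// addr_ge0// ltW.
- apply/measurable_EFinP; apply: measurable_funM; last exact: cmeasurable_csq.
  exact: measurable_shift.
rewrite -ge0_integralZl//; last 2 first.
- by apply/measurable_EFinP; exact: measurable_wcsq.
- by move=> x /ge x0; rewrite lee_fin mulr_ge0 ?csq_ge0 ?q0.
rewrite le_eqVlt; apply/orP; left; apply/eqP; apply: eq_integral => x _.
by rewrite -EFinD -EFinM /F; congr EFin; ring.
Qed.

End weights.
End weighted_estimate.

(** * Boundedness and the semigroup law *)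

Section semigroup.
Context {R : realType} (J : index_kind) (a : int -> R).
Local Notation Rp := ([set` `[0%R, +oo[] : set R).
Hypothesis adm : admissible_seq J a.
Implicit Types (f g : cfun R) (h k : Hsp R).

Lemma wnrm2_1 f : wnrm2 (cst 1) f = nrm2 f.
Proof. by apply: eq_integral => x _; rewrite mul1r. Qed.

(** The weighted estimate with both weights equal to 1, where the condition on reflected points
    reads 2 + 1 <= K. *)
Lemma Ta_inH_le t h : 0 < t -> inH h ->
  inH (Ta J a t h) /\ (nrmH (Ta J a t h) <= 3%:E * nrmH h)%E.
Proof.
move=> t0 hH; have [/inL2_cmeasurable m1 /inL2_cmeasurable m2] := hH.
have B : (nrmH (Ta J a t h) <= 3%:E * nrmH h)%E.
  rewrite /nrmH -!wnrm2_1; apply: weighted_Ta_le => //.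
  - by move=> x _; rewrite /cst; lra.
  - by move=> x _; rewrite /cst; lra.
  - by move=> n x _; rewrite /cst; split; lra.
split => //; have : (nrmH (Ta J a t h) < +oo)%E.
  apply: (le_lt_trans B); rewrite lte_mul_pinfty//.
  by rewrite ltey_eq nrmH_fin.
have pos f : (0 <= nrm2 f)%E by exact: nrm2_ge0.
move=> Bfin; have fin1 : (nrm2 (Ta J a t h).1 < +oo)%E.
  by apply: le_lt_trans Bfin; rewrite leeDl.
have fin2 : (nrm2 (Ta J a t h).2 < +oo)%E.
  by apply: le_lt_trans Bfin; rewrite leeDr.
have [? ?] : cmeasurable (Ta J a t h).1.
  by apply: cmeasurableD; [exact: cmeasurable_Lshift|exact: cmeasurable_Va].
have [? ?] : cmeasurable (Ta J a t h).2 by exact: cmeasurable_Rshift.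
by do 2 split.
Qed.

Lemma TaB t h k : Ta J a t (Hsub h k) = Hsub (Ta J a t h) (Ta J a t k).
Proof.
rewrite /Ta /Hsub /=; congr pair; apply/funext => x.
  by rewrite /Lshift /Va; case: ifP => _; ring.
by rewrite /Rshift; case: ifP; rewrite ?subrr.
Qed.

(** The off-diagonal entry of the semigroup law, V(s+t) = L(s)V(t) + V(s)R(t). The domain of index n
    for s + t is cut at [a n - s]: up to the cut V(t) reflects x + s, beyond it V(s) reflects x, and
    at most one of the two terms is nonzero. *)
Lemma Va_add (s t : R) g (x : R) : 0 < s -> 0 < t -> 0 <= x ->
  Va J a (s + t) g x = Va J a t g (x + s) + Va J a s (Rshift t g) x.
Proof.
move=> s0 t0 x0; have st0 : 0 < s + t by exact: addr_gt0.
have xs0 : 0 <= x + s by lra.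
have [[n [Jn _ n1 n2 n3]]|N1] := pselect (exists n, refl_dom J a t n (x + s)).
  have Dt : refl_dom J a t n (x + s) by split.
  have Dst : refl_dom J a (s + t) n x by split => //; lra.
  rewrite (Va_in adm _ t0 Dt) (Va_in adm _ st0 Dst).
  have -> : 2 * a n - t - (x + s) = 2 * a n - (s + t) - x by ring.
  have [[m Dm]|N2] := pselect (exists m, refl_dom J a s m x); last first.
    have -> : Va J a s (Rshift t g) x = 0.
      by apply: (Va_out adm) => // m Dm; apply: N2; exists m.
    by rewrite addr0.
  rewrite (Va_in adm _ s0 Dm) /Rshift; case: ifP => [y0|]; last by rewrite addr0.
  have [Jm _ m1 m2 m3] := Dm.
  have Dm' : refl_dom J a (s + t) m x by split => //; lra.
  by have E := refl_dom_inj adm Dm' Dst; subst m; exfalso; lra.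
have -> : Va J a t g (x + s) = 0.
  by apply: (Va_out adm) => // n Dn; apply: N1; exists n.
rewrite add0r.
have [[m Dm]|N2] := pselect (exists m, refl_dom J a s m x).
  rewrite (Va_in adm _ s0 Dm) /Rshift; have [Jm _ m1 m2 m3] := Dm.
  case: ifPn => [y0|]; last first.
    rewrite -ltNge => y0; apply: (Va_out adm) => // n [Jn _ n1 n2 n3].
    have [xn|xn] := leP x (a n - s).
      by apply: N1; exists n; split => //; lra.
    have Dn : refl_dom J a s n x by split => //; lra.
    by have E := refl_dom_inj adm Dn Dm; subst m; exfalso; lra.
  rewrite (Va_in adm (n := m))//; first by congr g; ring.
  by split => //; lra.
rewrite [RHS](Va_out adm)//; last by move=> m Dm; apply: N2; exists m.
apply: (Va_out adm) => // n [Jn _ n1 n2 n3].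
have [xn|xn] := leP x (a n - s); first by apply: N1; exists n; split => //; lra.
by apply: N2; exists n; split => //; lra.
Qed.

Lemma Ta_add (s t : R) h (x : R) : 0 < s -> 0 < t -> 0 <= x ->
  (Ta J a s (Ta J a t h)).1 x = (Ta J a (s + t) h).1 x /\
  (Ta J a s (Ta J a t h)).2 x = (Ta J a (s + t) h).2 x.
Proof.
move=> s0 t0 x0; rewrite /Ta /=; split.
  by rewrite Va_add// /Lshift addrA -[x + s + t]addrA.
rewrite /Rshift; case: ifP => [_|/negbT]; first by rewrite -addrA -opprD.
rewrite -ltNge => xs.
by case: ifPn => // xst; exfalso; lra.
Qed.

Lemma Ta0 h x : 0 <= x -> (Ta J a 0 h).1 x = h.1 x /\ (Ta J a 0 h).2 x = h.2 x.
Proof.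
by move=> x0; rewrite /Ta /= /Lshift Va_le0// addr0 addr0 /Rshift subr0 x0.
Qed.

End semigroup.

(** * Similarities by multiplication operators *)

Section weight_operators.
Context {R : realType}.
Local Notation Rp := ([set` `[0%R, +oo[] : set R).
Implicit Types (f g : cfun R) (h k : Hsp R) (u v p q : R -> R).

Lemma nrmHB_eq0 h k : (forall x, 0 <= x -> h.1 x = k.1 x /\ h.2 x = k.2 x) ->
  nrmH (Hsub h k) = 0%E.
Proof.
move=> hk; have -> : nrmH (Hsub h k) = nrmH ((fun=> 0, fun=> 0) : Hsp R).
  by apply: eq_nrmH => x /hk[E1 E2]; rewrite /= E1 E2 !subrr.
rewrite /nrmH /nrm2 /=; under eq_integral do rewrite csq0.
by rewrite integral0 adde0.
Qed.

Definition mulH u v h : Hsp R :=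
  (fun x => (u x)%:C%C * h.1 x, fun x => (v x)%:C%C * h.2 x).

Lemma bounded_op_mulH u v (C : R) :
  measurable_fun Rp u -> measurable_fun Rp v -> 0 <= C ->
  (forall x, 0 <= x -> u x ^+ 2 <= C) -> (forall x, 0 <= x -> v x ^+ 2 <= C) ->
  bounded_op (mulH u v).
Proof.
move=> mu_ mv C0 uC vC.
have le (w : R -> R) f x : (forall x, 0 <= x -> w x ^+ 2 <= C) -> 0 <= x ->
    csq ((w x)%:C%C * f x) <= C * csq (f x).
  by move=> wC x0; rewrite csqM csq_real ler_wpM2r ?csq_ge0 ?wC.
split; [|split].
- move=> h [h1 h2]; split.
    apply: (inL2_le _ h1 C0); first exact/cmeasurableM/inL2_cmeasurable.
    by move=> x; exact: le.
  apply: (inL2_le _ h2 C0); first exact/cmeasurableM/inL2_cmeasurable.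
  by move=> x; exact: le.
- by move=> c h k _ _; apply: nrmHB_eq0 => x _ /=; split; ring.
- exists C => h [h1 h2]; rewrite /nrmH muleDr//; last first.
    by rewrite ge0_adde_def// inE nrm2_ge0.
  have m f : inL2 f -> measurable_fun Rp (fun x => (csq (f x))%:E).
    by move=> f2; apply/measurable_EFinP; apply: cmeasurable_csq; exact: inL2_cmeasurable.
  apply: leeD; apply: nrm2_le_lin => //; try exact: m.
  + exact/cmeasurableM/inL2_cmeasurable.
  + by move=> x x0; rewrite -EFinM lee_fin le.
  + by move=> x _; rewrite lee_fin csq_ge0.
  + exact/cmeasurableM/inL2_cmeasurable.
  + by move=> x x0; rewrite -EFinM lee_fin le.
  + by move=> x _; rewrite lee_fin csq_ge0.
Qed.

Section weights.
Variables (p q : R -> R) (c C : R).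
Hypotheses (mp : measurable_fun Rp p) (mq : measurable_fun Rp q).
Hypothesis c0 : 0 < c.
Hypotheses (pc : forall x, 0 <= x -> c <= p x <= C) (qc : forall x, 0 <= x -> c <= q x <= C).

(** Square roots, because [nrmH] is a squared norm: it becomes the weighted norm with weights [p]
    and [q]. *)
Definition weight_op : Hsp R -> Hsp R :=
  mulH (fun x => p x `^ 2^-1) (fun x => q x `^ 2^-1).
Definition weight_op_inv : Hsp R -> Hsp R :=
  mulH (fun x => p x `^ (- 2^-1)) (fun x => q x `^ (- 2^-1)).

Let sqr_half (r : R) : 0 <= r -> (r `^ 2^-1) ^+ 2 = r.
Proof. by move=> r0; rewrite powR12_sqrt// sqr_sqrtr. Qed.

Let half_inv (r : R) : 0 < r -> r `^ 2^-1 * r `^ (- 2^-1) = 1.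
Proof.
move=> r0; rewrite powRN divff// gt_eqF// powR_gt0//.
Qed.

Let p_gt0 x : 0 <= x -> 0 < p x.
Proof. by move=> /pc /andP[+ _]; exact: lt_le_trans. Qed.

Let q_gt0 x : 0 <= x -> 0 < q x.
Proof. by move=> /qc /andP[+ _]; exact: lt_le_trans. Qed.

Lemma weight_opK h x : 0 <= x ->
  ((weight_op (weight_op_inv h)).1 x = h.1 x /\ (weight_op (weight_op_inv h)).2 x = h.2 x) /\
  ((weight_op_inv (weight_op h)).1 x = h.1 x /\ (weight_op_inv (weight_op h)).2 x = h.2 x).
Proof.
have K (u v : R) (z : R[i]) : u * v = 1 -> u%:C%C * (v%:C%C * z) = z.
  by move=> uv; rewrite mulrA -rmorphM uv rmorph1 mul1r.
move=> x0; have [px qx] := (p_gt0 x0, q_gt0 x0).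
by do 2 split; apply: K; rewrite ?half_inv// mulrC half_inv.
Qed.

Lemma bounded_invertible_weight_op : bounded_invertible weight_op weight_op_inv.
Proof.
have mpow r (u : R -> R) : measurable_fun Rp u -> measurable_fun Rp (fun x => u x `^ r).
  by move=> mu_; exact: (measurableT_comp (measurable_powR r) mu_).
have C0 : 0 <= C.
  by have /andP[/(lt_le_trans c0)/lt_le_trans/[apply]/ltW] := pc (lexx 0).
split; [|split; [|split]].
- apply: (bounded_op_mulH _ _ C0); [exact: mpow|exact: mpow| |] => x x0.
    by rewrite sqr_half ?(ltW (p_gt0 x0))//; have /andP[] := pc x0.
  by rewrite sqr_half ?(ltW (q_gt0 x0))//; have /andP[] := qc x0.
- have ci : 0 <= c^-1 by rewrite invr_ge0 ltW.
  have H (r : R) : c <= r -> (r `^ (- 2^-1)) ^+ 2 <= c^-1.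
    move=> cr; have r0 := lt_le_trans c0 cr.
    by rewrite powRN exprVn sqr_half ?(ltW r0)// lef_pV2 ?posrE.
  apply: (bounded_op_mulH _ _ ci); [exact: mpow|exact: mpow| |] => x x0.
    by apply: H; have /andP[] := pc x0.
  by apply: H; have /andP[] := qc x0.
- by move=> h _; apply: nrmHB_eq0 => x x0; have [] := weight_opK h x0.
- by move=> h _; apply: nrmHB_eq0 => x x0; have [] := weight_opK h x0.
Qed.

Lemma nrmH_weight_op h : nrmH (weight_op h) = (wnrm2 p h.1 + wnrm2 q h.2)%E.
Proof.
congr (_ + _)%E; apply: eq_integral => x /set_mem; rewrite /= in_itv/= andbT => x0.
  by rewrite csqM csq_real sqr_half// ltW// p_gt0.
by rewrite csqM csq_real sqr_half// ltW// q_gt0.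
Qed.

Lemma weight_op_Ta_le (J : index_kind) (a : int -> R) (t K : R) h :
  admissible_seq J a -> 0 < t -> 0 <= K ->
  (forall x, 0 <= x -> p x <= K * p (x + t)) ->
  (forall y, 0 <= y -> q (y + t) <= K * q y) ->
  (forall n x, refl_dom J a t n x ->
    2 * p x <= K * p (x + t) /\ 2 * p x + q (2 * a n - x) <= K * q (2 * a n - t - x)) ->
  inH h ->
  (nrmH (weight_op (Ta J a t (weight_op_inv h))) <= K%:E * nrmH h)%E.
Proof.
move=> adm t0 K0 Hp Hq Hpq hH.
have [_ [[invH _] _]] := bounded_invertible_weight_op.
rewrite nrmH_weight_op; apply: (le_trans (@weighted_Ta_le R J a adm t t0 p q K mp mq _ _ K0 Hp Hq Hpq _ (invH _ hH))).
- by move=> x /p_gt0/ltW.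
- by move=> x /q_gt0/ltW.
rewrite -nrmH_weight_op (eq_nrmH (k := h))// => x x0.
by have [] := weight_opK h x0.
Qed.

End weights.
End weight_operators.

(** * Sufficiency *)

Section one_sided_left.
Context {R : realType} (a : int -> R).
Local Notation Rp := ([set` `[0%R, +oo[] : set R).
Hypothesis adm : admissible_seq JZminus a.

(* The weight of the first component doubles under each step of length t on the
   part of the half-line met by the reflections; the weight of the second one
   decreases there by twice the maximum of the former. *)
Lemma similar_to_contraction_JZminus (t : R) :
  0 < t -> similar_to_contraction (Ta JZminus a t).
Proof.
move=> t0; have a0 : 0 < a 0 by rewrite (adm_gt0 adm).
(* For x in a reflection domain, x + t and [2 * a n - x] are at most [M]; capping there keeps the
   weights bounded without altering them at these points. [P] is the maximum of [p], and the slope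
   of [q] makes it fall by [2 * P] over a length [t]. *)
pose M := a 0 + t; pose p x := 2 `^ (Num.min x M / t); pose P := 2 `^ (M / t).
pose q x := 2 * P / t * (M - Num.min x M) + 1.
have M0 : 0 < M by rewrite addr_gt0.
have pP x : p x <= P by apply: ler_powR; [lra|rewrite ler_pM2r ?invr_gt0// ge_min lexx orbT].
have p1 x : 0 <= x -> 1 <= p x.
  move=> x0; rewrite -(powRr0 (2 : R)); apply: ler_powR; first lra.
  by rewrite divr_ge0 ?(ltW t0)// le_min x0 ltW.
have P1 : 1 <= P by exact: le_trans (p1 0 (lexx _)) (pP _).
have Pt0 : 0 <= 2 * P / t by rewrite divr_ge0 ?(ltW t0)//; lra.
have mmin : measurable_fun Rp (fun x : R => Num.min x M).
  by apply: measurable_minr.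
have mp : measurable_fun Rp p.
  apply: (measurableT_comp (measurable_powRr _)).
  exact: measurable_funM.
have mq : measurable_fun Rp q.
  apply: measurable_funD => //; apply: measurable_funM => //.
  exact: measurable_funB.
pose C := Num.max P (2 * P / t * M + 1).
have pC x : 0 <= x -> 1 <= p x <= C.
  by move=> x0; rewrite p1//= le_max pP.
have qC x : 0 <= x -> 1 <= q x <= C.
  move=> x0; rewrite le_max /q; apply/andP; split; last (apply/orP; right).
    by rewrite lerDr mulr_ge0// subr_ge0 ge_min lexx orbT.
  by rewrite lerD2r ler_wpM2l// gerBl le_min x0 ltW.
exists (weight_op p q), (weight_op_inv p q).
split; first exact: (bounded_invertible_weight_op mp mq ltr01 pC qC).
move=> h hH; rewrite -[leRHS]mul1e.
apply: (weight_op_Ta_le mp mq ltr01 pC qC adm t0 ler01) => //.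
- move=> x x0; rewrite mul1r; apply: ler_powR; first lra.
  by rewrite ler_pM2r ?invr_gt0// le_min !ge_min lexx orbT andbT lerDl (ltW t0).
- move=> y y0; rewrite mul1r /q lerD2r ler_wpM2l// lerD2l lerN2.
  by rewrite le_min !ge_min lexx orbT andbT lerDl (ltW t0).
move=> n x [Jn x0 n1 n2 n3].
have an : a n <= a 0 by apply: (adm_le adm).
have pE : 2 * p x = p (x + t).
  rewrite /p !min_l ?/M; [|lra|lra].
  have -> : (x + t) / t = x / t + 1 by field; rewrite gt_eqF.
  rewrite (@powRD _ 2 (x / t) 1) ?pnatr_eq0 ?implybT//.
  by rewrite powRr1 1?mulrC//; lra.
rewrite !mul1r -pE; split => //.
rewrite /q !min_l ?/M; [|lra|lra].
have -> : 2 * P / t * (M - (2 * a n - t - x)) = 2 * P / t * (M - (2 * a n - x)) + 2 * P.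
  by field; rewrite gt_eqF.
by have := pP x; rewrite /M; lra.
Qed.

End one_sided_left.

(** * Quasi-contractivity when the sequence is bounded away from 0 *)

Section one_sided_right.
Context {R : realType} (a : int -> R).
Local Notation Rp := ([set` `[0%R, +oo[] : set R).
Hypothesis adm : admissible_seq JZplus a.

(** The length over which the weights relax. Since [a n / 2 + w <= a n - w], the effect of earlier
    terms has died out on the window of length [w] before [a n]. *)
Let w : R := a 0 / 4.

Let w0 : 0 < w.
Proof. by rewrite divr_gt0// (adm_gt0 adm). Qed.

Let wE : a 0 = 4 * w.
Proof. by rewrite /w; field. Qed.

Let a0_le n : 0 <= n -> a 0 <= a n.
Proof. by move=> n0; apply: (adm_le adm). Qed.

(* The last term of the sequence before x, or -w if there is none; the boolean
   tells whether x itself counts. *)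
Let before (b : bool) (x : R) : set R :=
  [set - w] `|` [set r | exists n, [/\ 0 <= n, r = a n & r < x ?<= if b]].
Let last_before b x : R := sup (before b x).

Let before_ub b x : 0 <= x -> ubound (before b x) x.
Proof.
move=> x0 _ [->|[n [n0 -> /lteifW//]]].
by apply: le_trans x0; rewrite oppr_le0 ltW.
Qed.

Let before_neq0 b x : before b x !=set0.
Proof. by exists (- w); left. Qed.

Let before_has_ub b x : has_ubound (before b x).
Proof.
exists (Num.max x 0) => _ [->|[n [n0 -> /lteifW xn]]]; rewrite le_max ?xn//.
by rewrite oppr_le0 (ltW w0) orbT.
Qed.

Let last_before_ge b x n : 0 <= n -> a n < x ?<= if b -> a n <= last_before b x.
Proof.
by move=> n0 nx; apply: ub_le_sup; [exact: before_has_ub|right; exists n].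
Qed.

Let last_before_le b x (B : R) : - w <= B ->
  (forall n, 0 <= n -> a n < x ?<= if b -> a n <= B) -> last_before b x <= B.
Proof.
move=> wB H; apply: ge_sup; first exact: before_neq0.
by move=> _ [->//|[n [n0 -> /(H _ n0)]]].
Qed.

Let last_before_nd b x y : x <= y -> last_before b x <= last_before b y.
Proof.
move=> xy; apply: last_before_le; first by apply: ub_le_sup; [exact: before_has_ub|left].
move=> n n0 nx; apply: last_before_ge => //.
by case: (b) nx => /= nx; [exact: le_trans xy|exact: lt_le_trans xy].
Qed.

(** A sawtooth that jumps to 1 at each term of the sequence and falls to 0 with slope [1 / w]. The
    starting value [- w] in [before] makes it vanish on the half-line before the first term. *)
Let bump b x : R := Num.max 0 (1 - (x - last_before b x) / w).

Let measurable_bump b : measurable_fun Rp (bump b).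
Proof.
apply: measurable_maxr => //; apply: measurable_funB => //.
apply: measurable_funM => //; apply: measurable_funB => //.
by apply: nondecreasing_measurable => // x y; exact: last_before_nd.
Qed.

Let bump_ge0 b x : 0 <= bump b x.
Proof. by rewrite le_max lexx. Qed.

Let bump_le1 b x : 0 <= x -> bump b x <= 1.
Proof.
move=> x0; rewrite ge_max ler01/= gerBl divr_ge0 ?(ltW w0)// subr_ge0.
by apply: ge_sup; [exact: before_neq0|exact: before_ub].
Qed.

(** The last term before a point moves only to the right, so a shift lowers the sawtooth at most at
    its slope; upward jumps do no harm here. *)
Let bump_shift b x t : 0 <= t -> bump b x <= bump b (x + t) + t / w.
Proof.
move=> t0; have tw : 0 <= t / w by rewrite divr_ge0// ltW.
rewrite {1}/bump ge_max addr_ge0//=.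
apply: (@le_trans _ _ (1 - (x + t - last_before b (x + t)) / w + t / w)); last first.
  by rewrite lerD2r le_max lexx orbT.
have : last_before b x / w <= last_before b (x + t) / w.
  by rewrite ler_pM2r ?invr_gt0// last_before_nd// lerDl.
by rewrite !mulrDl !mulNr; lra.
Qed.

Let bump_before b x n : 0 <= n -> a n - w <= x -> (b ==> (x < a n)) -> x <= a n -> bump b x = 0.
Proof.
move=> n0 nx bn xn; apply/max_idPl; rewrite subr_le0 ler_pdivlMr// mul1r.
suff : last_before b x <= a n / 2 by have := a0_le n0; rewrite wE; lra.
apply: last_before_le; first by have := a0_le n0; rewrite wE; move: w0; lra.
move=> m m0 mx; suff mn : m < n by have := adm_double adm m0 n0 mn; lra.
have amn : a m < a n.
  by case: (b) bn mx => /= [xn'|_] mx; [exact: le_lt_trans xn'|exact: lt_le_trans xn].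
rewrite ltNge; apply/negP => nm.
by have := adm_le adm n0 m0 nm; rewrite leNgt amn.
Qed.

Let bump_after b x n t : 0 <= n -> a n < x ?<= if b -> x <= a n + t -> 1 - t / w <= bump b x.
Proof.
move=> n0 nx xt; rewrite le_max; apply/orP; right.
rewrite lerD2l lerN2 ler_pM2r ?invr_gt0//.
have := last_before_ge n0 nx; lra.
Qed.

Lemma similar_to_quasi_contraction_JZplus :
  similar_to_quasi_contraction_sg (Ta JZplus a).
Proof.
(* At [a n] the weight [p] jumps from 1 to 2 and [q] from 4 to 2, which balances 2 * 1 + 2 = 4 at a
   reflected point. The booleans match the half-open domains: x <= a n < x + t, whereas 2 a n - t -
   x < a n <= 2 a n - x. *)
pose p x := 1 + bump false x; pose q x := 4 - 2 * bump true x.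
have mp : measurable_fun Rp p by apply: measurable_funD.
have mq : measurable_fun Rp q by apply: measurable_funB => //; apply: measurable_funM.
have pC x : 0 <= x -> 1 <= p x <= 4.
  move=> x0; have := bump_ge0 false x; have := bump_le1 false x0.
  by move=> ? ?; apply/andP; rewrite /p; split; lra.
have qC x : 0 <= x -> 1 <= q x <= 4.
  move=> x0; have := bump_ge0 true x; have := bump_le1 true x0.
  by move=> ? ?; apply/andP; rewrite /q; split; lra.
(* Squaring turns this exponent into [3 * t / w], whose exponential dominates the factor [1 + 3 * s]
   obtained below. *)
exists (weight_op p q), (weight_op_inv p q), (3 / (2 * w)).
split; first exact: (bounded_invertible_weight_op mp mq ltr01 pC qC).
move=> t; rewrite le_eqVlt => /predU1P[<- h hH|t0 h hH].
  rewrite mulr0 expR0 expr1n mul1e (eq_nrmH (k := h))// => x x0.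
  have [<- <-] := (weight_opK ltr01 pC qC h x0).1.
  rewrite /weight_op /mulH /=.
  by have [/= -> ->] := Ta0 JZplus a (weight_op_inv p q h) x0.
pose s := t / w; have s0 : 0 < s by rewrite divr_gt0.
have K0 : 0 <= 1 + 3 * s by lra.
apply: (@le_trans _ _ ((1 + 3 * s)%:E * nrmH h)%E); last first.
  apply: lee_wpmul2r; first exact: nrmH_ge0.
  rewrite lee_fin -expRM_natl.
  apply: le_trans (expR_ge1Dx _); rewrite lerD2l le_eqVlt; apply/orP; left.
  by apply/eqP; rewrite /s; field; rewrite gt_eqF.
apply: (weight_op_Ta_le mp mq ltr01 pC qC adm t0 K0) => //.
- move=> x x0; have := bump_shift false x (ltW t0); rewrite -/s /p.
  have := bump_ge0 false (x + t); set u := bump _ (x + t) => u0 xu.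
  by have := mulr_ge0 (ltW s0) u0; lra.
- move=> y y0; have := bump_shift true y (ltW t0); rewrite -/s /q.
  have := bump_le1 true y0; set u := bump _ y => u1 yu.
  have : 0 <= s * (1 - u) by rewrite mulr_ge0 ?(ltW s0)// subr_ge0.
  lra.
move=> n x [Jn x0 n1 n2 n3].
have y0 : 0 <= 2 * a n - t - x by lra.
have xt0 : 0 <= x + t by lra.
have yt0 : 0 <= 2 * a n - x by lra.
have [tw|wt] := leP t w.
  have -> : p x = 1 by rewrite /p (bump_before Jn) ?addr0//; lra.
  have -> : q (2 * a n - t - x) = 4 by rewrite /q (bump_before Jn) ?mulr0 ?subr0//=; lra.
  have u1 : 1 - s <= bump false (x + t).
    by apply: (bump_after Jn) => /=; lra.
  have v1 : 1 - s <= bump true (2 * a n - x).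
    by apply: (bump_after Jn) => /=; lra.
  have s1 : s <= 1 by rewrite ler_pdivrMr// mul1r.
  rewrite /p /q; split; last lra.
  have : 0 <= (1 + 3 * s) * (bump false (x + t) - (1 - s)).
    by rewrite mulr_ge0 ?subr_ge0//; lra.
  have : 0 <= s * (1 - s) by rewrite mulr_ge0 ?subr_ge0// ltW.
  lra.
(* For t > w the factor [1 + 3 * s] exceeds 4, and the bounds 1 <= p <= 2 and 2 <= q <= 4
   suffice. *)
have s1 : 1 < s by rewrite ltr_pdivlMr// mul1r.
have /andP[_ px] := pC _ x0; have /andP[pxt _] := pC _ xt0.
have /andP[_ qy] := qC _ yt0; have /andP[qyt _] := qC _ y0.
have px2 : p x <= 2 by rewrite /p; have := bump_le1 false x0; lra.
have q2 : 2 <= q (2 * a n - t - x) by rewrite /q; have := bump_le1 true y0; lra.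
split.
  have : 0 <= (1 + 3 * s) * (p (x + t) - 1) by rewrite mulr_ge0 ?subr_ge0.
  lra.
have : 0 <= (1 + 3 * s) * (q (2 * a n - t - x) - 2) by rewrite mulr_ge0 ?subr_ge0.
lra.
Qed.

End one_sided_right.

(** * Necessity *)

Section quadratic_inequality.
Context {R : realType}.
Local Notation Rp := ([set` `[0%R, +oo[] : set R).
Implicit Types (f g : cfun R) (h : Hsp R).

(** Expanding the squares leaves one cross term between [z] and the sum W of the [w k]. Half of M
    |z|^2 absorbs it, by completing the square |z + (2/M) W|^2. *)
Lemma csq_sum_ge (M : nat) (z : R[i]) (w : nat -> R[i]) : (0 < M)%N ->
  M%:R / 2 * csq z + \sum_(k < M) csq (w k) <=
  \sum_(k < M) csq (z + w k) + 2 / M%:R * csq (\sum_(k < M) w k).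
Proof.
move=> M0; pose B (u v : R[i]) := complex.Re u * complex.Re v + complex.Im u * complex.Im v.
have csqD u v : csq (u + v) = csq u + 2 * B u v + csq v.
  by case: u v => [u1 u2] [v1 v2]; rewrite /csq /B /=; ring.
have Bsum : \sum_(k < M) B z (w k) = B z (\sum_(k < M) w k).
  elim: (M) => [|m IH]; first by rewrite !big_ord0 /B /=; ring.
  rewrite !big_ord_recr /= IH; case: (\sum_(i < m) w i) (w m) => [u1 u2] [v1 v2].
  by rewrite /B /=; ring.
have -> : \sum_(k < M) csq (z + w k) =
    M%:R * csq z + 2 * B z (\sum_(k < M) w k) + \sum_(k < M) csq (w k).
  have -> : M%:R * csq z = \sum_(k < M) csq z by rewrite sumr_const card_ord mulr_natl.
  rewrite -Bsum mulr_sumr -!big_split; apply: eq_bigr => k _; exact: csqD.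
set W := \sum_(k < M) w k; have M0' : 0 < M%:R :> R by rewrite ltr0n.
have : 0 <= M%:R / 2 * csq (z + (2 / M%:R)%:C%C * W).
  by rewrite mulr_ge0 ?csq_ge0// divr_ge0// ltW.
have BZ (r : R) : B z (r%:C%C * W) = r * B z W.
  by case: (z) W => [u1 u2] [v1 v2]; rewrite /B /=; ring.
rewrite csqD BZ csqM csq_real.
have -> : M%:R / 2 * (csq z + 2 * (2 / M%:R * B z W) + (2 / M%:R) ^+ 2 * csq W) =
   M%:R / 2 * csq z + 2 * B z W + 2 / M%:R * csq W.
  by field; rewrite gt_eqF.
by lra.
Qed.

Lemma cmeasurable_sum (M : nat) (w : nat -> cfun R) :
  (forall k, cmeasurable (w k)) -> cmeasurable (fun x => \sum_(k < M) w k x).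
Proof.
move=> mw; elim: M => [|M IH].
  have -> : (fun x => \sum_(k < 0) w k x) = cst 0 by apply/funext => x; rewrite big_ord0.
  by split; exact: measurable_cst.
rewrite (_ : (fun x => _) = (fun x => \sum_(k < M) w k x + w M x)); first exact: cmeasurableD.
by apply/funext => x; rewrite big_ord_recr.
Qed.

Lemma nrm2_sum_ge (M : nat) f (w : nat -> cfun R) : (0 < M)%N ->
  cmeasurable f -> (forall k, cmeasurable (w k)) ->
  ((M%:R / 2)%:E * nrm2 f + \sum_(k < M) nrm2 (w k) <=
  \sum_(k < M) nrm2 (fun x => f x + w k x)%R +
    (2 / M%:R)%:E * nrm2 (fun x => \sum_(k < M) w k x)%R)%E.
Proof.
move=> M0 mf mw.
have mE u : cmeasurable u -> measurable_fun Rp (fun x => (csq (u x))%:E).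
  by move=> m; apply/measurable_EFinP; exact: cmeasurable_csq.
have g0 (u : cfun R) x : (0 <= (csq (u x))%:E)%E by rewrite lee_fin csq_ge0.
have M0' : 0 < M%:R :> R by rewrite ltr0n.
have c1 : 0 <= M%:R / 2 :> R by rewrite divr_ge0// ltW.
have c2 : 0 <= 2 / M%:R :> R by rewrite divr_ge0// ltW.
have ms := cmeasurable_sum M mw.
have mfw k : cmeasurable (fun x => f x + w k x) by exact: cmeasurableD.
rewrite /nrm2 -!ge0_integral_sum//; try (by move=> k; exact: mE);
  try (by move=> *; rewrite lee_fin csq_ge0).
rewrite -!ge0_integralZl//; try exact: mE;
  try (by move=> *; rewrite lee_fin csq_ge0).
have msum (u : nat -> cfun R) : (forall k, cmeasurable (u k)) ->
    measurable_fun Rp (fun x => \sum_(k < M) (csq (u k x))%:E)%E.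
  by move=> mu_; apply: emeasurable_sum => k; exact: mE.
rewrite -!ge0_integralD//;
  try (by move=> x _; apply: sume_ge0 => k _; rewrite lee_fin csq_ge0);
  try (by move=> x _; rewrite mule_ge0// lee_fin csq_ge0);
  try (by apply: measurable_funeM; exact: mE);
  try exact: msum; try exact: (msum (fun k x => f x + w k x)).
apply: ge0_le_integral => //.
- by move=> x _; rewrite adde_ge0 ?mule_ge0 ?sume_ge0.
- by apply: emeasurable_funD; [apply: measurable_funeM; exact: mE|exact: msum].
- apply: emeasurable_funD; last by apply: measurable_funeM; exact: mE.
  exact: (msum (fun k x => f x + w k x)).
- move=> x _; rewrite !sumEFin -!EFinM -!EFinD lee_fin.
  exact: (csq_sum_ge (f x) (fun k => w k x)).
Qed.

Definition hsum (r : nat -> Hsp R) (M : nat) : Hsp R :=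
  (fun x => \sum_(k < M) (r k).1 x, fun x => \sum_(k < M) (r k).2 x).

Lemma hsumS r M : hsum r M.+1 = Hadd (hsum r M) (r M).
Proof. by rewrite /hsum /Hadd; congr pair; apply/funext => x; rewrite big_ord_recr. Qed.

Lemma inH_hsum r M : (forall i, inH (r i)) -> inH (hsum r M).
Proof.
move=> rH; elim: M => [|M IH]; last by rewrite hsumS; exact: inHD.
have -> : hsum r 0 = (fun=> 0, fun=> 0).
  by rewrite /hsum; congr pair; apply/funext => x; rewrite big_ord0.
by split; exact: inL2_0.
Qed.

Lemma nrmH_sum_ge (M : nat) h (r : nat -> Hsp R) : (0 < M)%N ->
  inH h -> (forall i, inH (r i)) ->
  M%:R / 2 * fine (nrmH h) + \sum_(k < M) fine (nrmH (r k)) <=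
  \sum_(k < M) fine (nrmH (Hadd h (r k))) + 2 / M%:R * fine (nrmH (hsum r M)).
Proof.
move=> M0 hH rH; rewrite -lee_fin !EFinD !EFinM -!sumEFin.
have hrH k : inH (Hadd h (r k)) by exact: inHD.
have sH := inH_hsum M rH.
rewrite !fineK ?nrmH_fin//.
under eq_bigr do rewrite fineK ?nrmH_fin//.
under [X in (_ <= X + _)%E]eq_bigr do rewrite fineK ?nrmH_fin//.
have [/inL2_cmeasurable h1 /inL2_cmeasurable h2] := hH.
have r1 k : cmeasurable (r k).1 by have [/inL2_cmeasurable] := rH k.
have r2 k : cmeasurable (r k).2 by have [_ /inL2_cmeasurable] := rH k.
have := leeD (nrm2_sum_ge M0 h1 r1) (nrm2_sum_ge M0 h2 r2).
rewrite addeACA [X in (_ <= X)%E -> _]addeACA -!muleDr ?ge0_adde_def ?inE ?nrm2_ge0//.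
by rewrite -!big_split.
Qed.

End quadratic_inequality.

(** * Bounded operators, null functions and finite sums *)

Section bounded_operators.
Context {R : realType}.
Implicit Types (h k l : Hsp R) (S : Hsp R -> Hsp R).

Lemma Hsub_eq0_trans h k l : inH h -> inH k -> inH l ->
  nrmH (Hsub h k) = 0%E -> nrmH (Hsub k l) = 0%E -> nrmH (Hsub h l) = 0%E.
Proof.
move=> hH kH lH hk kl; apply/eqP; rewrite eq_le nrmH_ge0 andbT.
have -> : Hsub h l = Hadd (Hsub h k) (Hsub k l).
  by rewrite /Hadd /Hsub /=; congr pair; apply/funext => x; ring.
apply: le_trans (nrmHD_le (inHB hH kH) (inHB kH lH)) _.
by rewrite hk kl adde0 mule0.
Qed.

(** Operators act on functions rather than on classes; linearity with the scalar -1 and the bound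
    make them compatible with equality almost everywhere. *)
Lemma bounded_opB S h k : bounded_op S -> inH h -> inH k ->
  nrmH (Hsub h k) = 0%E -> nrmH (Hsub (S h) (S k)) = 0%E.
Proof.
move=> [SH [lin [C bnd]]] hH kH hk.
have E (u v : Hsp R) : Hadd (Hscale (-1) v) u = Hsub u v.
  by rewrite /Hadd /Hscale /Hsub /=; congr pair; apply/funext => x; ring.
have := lin (-1) k h kH hH; rewrite !E => Slin.
have hkH := inHB hH kH; have ShkH := inHB (SH _ hH) (SH _ kH).
rewrite -(nrmHB0 (SH _ hkH) ShkH Slin).
by apply/eqP; rewrite eq_le nrmH_ge0 andbT (le_trans (bnd _ hkH))// hk mule0.
Qed.

Lemma bounded_opD S h k : bounded_op S -> inH h -> inH k ->
  nrmH (Hsub (S (Hadd h k)) (Hadd (S h) (S k))) = 0%E.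
Proof.
move=> [SH [lin _]] hH kH; have := lin 1 h k hH kH.
have E (u : Hsp R) : Hscale 1 u = u.
  by case: u => u1 u2; rewrite /Hscale /=; congr pair; apply/funext => x; ring.
by rewrite !E.
Qed.

Lemma bounded_op_hsum S (r : nat -> Hsp R) M : bounded_op S -> (forall i, inH (r i)) ->
  nrmH (Hsub (S (hsum r M)) (hsum (S \o r) M)) = 0%E.
Proof.
move=> Sb rH; have [SH [_ [C bnd]]] := Sb; have SrH i : inH ((S \o r) i) by exact: SH.
elim: M => [|M IH].
  have E (u : nat -> Hsp R) : hsum u 0 = (fun=> 0, fun=> 0).
    by rewrite /hsum; congr pair; apply/funext => x; rewrite big_ord0.
  have z0 : nrmH ((fun=> 0, fun=> 0) : Hsp R) = 0%E.
    rewrite /nrmH /nrm2 /=; under eq_integral do rewrite csq0.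
    by rewrite integral0 adde0.
  have zH : inH ((fun=> 0, fun=> 0) : Hsp R) by split; exact: inL2_0.
  rewrite !E (eq_nrmH (k := S (fun=> 0, fun=> 0))); last by move=> x _ /=; rewrite !subr0.
  by apply/eqP; rewrite eq_le nrmH_ge0 andbT (le_trans (bnd _ zH))// z0 mule0.
have [rM SrM] := (inH_hsum M rH, inH_hsum M SrH).
rewrite !hsumS; apply: (Hsub_eq0_trans _ _ _ (bounded_opD Sb rM (rH M))).
- exact/SH/inHD.
- exact/inHD/(SrH M)/SH.
- exact/inHD/(SrH M).
rewrite -IH; apply: eq_nrmH => x _ /=; split; ring.
Qed.

End bounded_operators.

Section chain_bound.
Context {R : realType}.
Implicit Types (h : Hsp R) (S : Hsp R -> Hsp R).

(* Expanding the squares shows that every step x + r_(k+1) loses the norm of x,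
   up to cross terms which only see the sum of the r_k. *)
Lemma chain_bound S S' : bounded_invertible S S' ->
  exists2 C : R, 0 < C & forall (M : nat) (x : Hsp R) (r : nat -> Hsp R) (b s : R),
    (0 < M)%N -> inH x -> (forall k, inH (r k)) ->
    (forall k, (k < M)%N ->
      (nrmH (S (Hadd x (r k.+1))) <= (1 + M%:R^-1)%:E * nrmH (S (r k)))%E) ->
    (forall k, fine (nrmH (r k)) <= b) ->
    fine (nrmH (hsum (fun k => r k.+1) M)) <= s ->
    M%:R * fine (nrmH x) <= C * (b + s / M%:R).
Proof.
move=> [Sb [S'b [_ S'S]]]; have [SH [_ [C1 bnd1]]] := Sb; have [S'H [_ [C2 bnd2]]] := S'b.
pose N h := fine (nrmH (S h)).
have N0 h : 0 <= N h by rewrite fine_ge0 ?nrmH_ge0.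
pose D1 := Num.max C1 1; pose D2 := Num.max C2 1.
have D10 : 0 < D1 by rewrite lt_max ltr01 orbT.
have D20 : 0 < D2 by rewrite lt_max ltr01 orbT.
have NE h : inH h -> nrmH (S h) = (N h)%:E by move=> hH; rewrite fineK ?nrmH_fin//; exact: SH.
have le1 h : inH h -> N h <= D1 * fine (nrmH h).
  move=> hH; rewrite -lee_fin -NE// EFinM fineK ?nrmH_fin//.
  apply: le_trans (bnd1 _ hH) _; apply: lee_wpmul2r; first exact: nrmH_ge0.
  by rewrite lee_fin le_max lexx.
have le2 h : inH h -> fine (nrmH h) <= D2 * N h.
  move=> hH; rewrite -lee_fin fineK ?nrmH_fin// EFinM -NE//.
  rewrite -(nrmHB0 (S'H _ (SH _ hH)) hH (S'S _ hH)).
  apply: le_trans (bnd2 _ (SH _ hH)) _; apply: lee_wpmul2r; first exact: nrmH_ge0.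
  by rewrite lee_fin le_max lexx.
exists (4 * D1 * D2); first by rewrite !mulr_gt0.
move=> M x r b s M0 xH rH step rb rs.
have M0' : 0 < M%:R :> R by rewrite ltr0n.
pose r' k := r k.+1; have r'H k : inH (r' k) by exact: rH.
have SrH k : inH ((S \o r') k) by exact/SH/r'H.
have := nrmH_sum_ge M0 (SH _ xH) SrH.
have -> : nrmH (hsum (S \o r') M) = nrmH (S (hsum r' M)).
  apply/esym/nrmHB0; [exact/SH/inH_hsum|exact: inH_hsum|].
  exact: bounded_op_hsum.
have := le1 _ (inH_hsum M r'H); rewrite -/(N (hsum r' M)) => sumN.
have stepN k : (k < M)%N ->
    fine (nrmH (Hadd (S x) ((S \o r') k))) <= (1 + M%:R^-1) * N (r k).
  move=> kM; have xr := inHD xH (r'H k).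
  rewrite -(nrmHB0 (SH _ xr) (inHD (SH _ xH) (SrH k)) (bounded_opD Sb xH (r'H k))).
  by rewrite -lee_fin EFinM -NE// fineK ?nrmH_fin//; [exact: step|exact: SH].
have {}stepN : \sum_(k < M) fine (nrmH (Hadd (S x) ((S \o r') k))) <=
    (1 + M%:R^-1) * \sum_(k < M) N (r k).
  by rewrite mulr_sumr; apply: ler_sum => k _; exact: stepN.
have Nb k : N (r k) <= D1 * b.
  by apply: (le_trans (le1 _ (rH k))); rewrite ler_pM2l.
(* The sums over [r k] and [r k.+1] telescope, and only the initial term survives as an upper
   bound. *)
have shift : \sum_(k < M) N (r k) <= N (r 0%N) + \sum_(k < M) N (r' k).
  have : \sum_(k < M.+1) N (r k) = N (r 0%N) + \sum_(k < M) N (r' k).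
    by rewrite big_ord_recl.
  by rewrite big_ord_recr /= => <-; rewrite lerDl.
(* The M relative errors 1/M together cost no more than a single bound on [N (r k)]. *)
have sumb : M%:R^-1 * \sum_(k < M) N (r k) <= D1 * b.
  rewrite ler_pdivrMl//; apply: (@le_trans _ _ (\sum_(k < M) D1 * b)).
    by apply: ler_sum => k _; exact: Nb.
  by rewrite sumr_const card_ord mulr_natl.
have s1 : 2 / M%:R * N (hsum r' M) <= 2 / M%:R * (D1 * s).
  rewrite ler_pM2l ?divr_gt0//; apply: (le_trans sumN).
  by rewrite ler_pM2l.
rewrite -/(N x) -/(N (hsum r' M)) => main.
have main2 : M%:R / 2 * N x <= 2 * D1 * (b + s / M%:R).
  have -> : 2 * D1 * (b + s / M%:R) = 2 * D1 * b + 2 / M%:R * (D1 * s) by ring.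
  have := Nb 0%N; move: main stepN shift sumb s1; rewrite !mulrDl mul1r /=.
  set A := \sum_(k < M) fine (nrmH (S (r' k))).
  rewrite -/A /N; lra.
apply: (@le_trans _ _ (M%:R * (D2 * N x))); first by rewrite ler_pM2l// le2.
have := ler_wpM2l (ltW (mulr_gt0 (ltr0n R 2) D20)) main2; lra.
Qed.

End chain_bound.

(** * Orbits of indicator functions *)

Section indicator_orbits.
Context {R : realType} (J : index_kind) (a : int -> R).
Local Notation Rp := ([set` `[0%R, +oo[] : set R).
Hypothesis adm : admissible_seq J a.

Definition box (B x : R) : R := if 0 <= x < B then 1 else 0.
Definition cbox (B : R) : cfun R := fun x => (box B x)%:C%C.
Definition box1 (B : R) : Hsp R := (cbox B, fun=> 0).
Definition box2 (B : R) : Hsp R := (fun=> 0, cbox B).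

Lemma boxE B : box B = \1_([set` `[0, B[]).
Proof. by apply/funext => x; rewrite /box indicE mem_setE in_itv/=; case: ifP. Qed.

Lemma measurable_real_cmeasurable (u : R -> R) :
  measurable_fun Rp u -> cmeasurable (fun x => (u x)%:C%C).
Proof. by move=> mu_; split => //=; exact: measurable_cst. Qed.

Lemma nrm2_real_le (u : R -> R) (m : R) (E : set R) (l : R) :
  measurable_fun Rp u -> measurable E -> 0 <= m -> (mu E <= l%:E)%E ->
  (forall x, 0 <= x -> u x ^+ 2 <= m * \1_E x) ->
  (nrm2 (fun x => (u x)%:C%C) <= (m * l)%:E)%E.
Proof.
move=> mu_ mE m0 El uE; rewrite EFinM.
apply: (@le_trans _ _ (m%:E * \int[mu]_(x in Rp) (\1_E x)%:E)%E).
  have mi : measurable_fun Rp (fun x => (\1_E x)%:E : \bar R).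
    by apply/measurable_EFinP; exact: measurable_indic.
  apply: (nrm2_le_lin m0 (measurable_real_cmeasurable mu_) mi) => x x0.
    by rewrite csq_real -EFinM lee_fin uE.
  by rewrite lee_fin.
apply: lee_wpmul2l => //; rewrite integral_indic//.
by apply: le_trans El; apply: le_measure; rewrite ?inE//; exact: measurableI.
Qed.

Lemma lebesgue_itv_le (b0 b1 : bool) (c d l : R) : 0 <= l -> d - c <= l ->
  (mu ([set` Interval (BSide b0 c) (BSide b1 d)] : set R) <= l%:E)%E.
Proof.
move=> l0 cd; rewrite lebesgue_measure_itv/=; case: ifP => _; last by rewrite lee_fin.
by rewrite -EFinB lee_fin.
Qed.

Lemma nrm2_cbox B : 0 <= B -> nrm2 (cbox B) = B%:E.
Proof.
move=> B0.
have -> : (nrm2 (cbox B) = \int[mu]_(x in Rp) (\1_([set` `[0%R, B[]) x)%:E)%E.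
  apply: eq_integral => x _; rewrite csq_real boxE indicE.
  by case: (_ \in _); rewrite ?expr1n ?expr0n.
rewrite integral_indic// setIidl; last first.
  by move=> x /=; rewrite !in_itv/= andbT => /andP[].
have := @lebesgue_measure_itv R `[0%R, B[; rewrite /= => ->; rewrite lte_fin; case: ifPn => [_|]; first by rewrite oppr0 adde0.
by rewrite -leNgt => B0'; congr EFin; apply/eqP; rewrite eq_le B0 B0'.
Qed.

Lemma inL2_cbox B : 0 <= B -> inL2 (cbox B).
Proof.
move=> B0; have [m1 m2] : cmeasurable (cbox B).
  by apply: measurable_real_cmeasurable; rewrite boxE; exact: measurable_indic.
by do 2 split => //; rewrite nrm2_cbox// ltry.
Qed.

Lemma nrm2_0 : nrm2 (fun=> 0 : R[i]) = 0%E.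
Proof. by rewrite /nrm2; under eq_integral do rewrite csq0; rewrite integral0. Qed.

Lemma nrmH_box1 B : 0 <= B -> nrmH (box1 B) = B%:E.
Proof. by move=> B0; rewrite /nrmH nrm2_cbox// nrm2_0 adde0. Qed.

Lemma inH_box1 B : 0 <= B -> inH (box1 B).
Proof. by move=> B0; split; [exact: inL2_cbox|exact: inL2_0]. Qed.

Lemma inH_box2 B : 0 <= B -> inH (box2 B).
Proof. by move=> B0; split; [exact: inL2_0|exact: inL2_cbox]. Qed.

(** At these times only index m reaches [[0, B[]: smaller indices have empty domains because
    [2 * a n <= a m < t], and larger ones reflect to points at or beyond [a n - t >= B]. *)
Lemma Va_cbox m (B th t x : R) : 0 < B -> 0 <= th -> inJ J m -> B + th < a m ->
  2 * a m - B - th <= t -> t <= 2 * a m - B -> 0 <= x ->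
  Va J a t (cbox B) x = cbox B (2 * a m - t - x).
Proof.
move=> B0 th0 Jm am t1 t2 x0; have t0 : 0 < t by lra.
have [[n Dn]|N] := pselect (exists n, refl_dom J a t n x); last first.
  rewrite (Va_out adm)//; last by move=> n Dn; apply: N; exists n.
  rewrite /cbox /box; case: ifP => // /andP[y0 yB]; case: N.
  by exists m; split => //; lra.
rewrite (Va_in adm _ t0 Dn).
have [->//|nm] := eqVneq n m; have [Jn _ n1 n2 n3] := Dn.
have [mn|mn] := ltP m n.
  have := adm_double adm Jm Jn mn => d; rewrite /cbox /box !ifF//.
    by apply/negP => /andP[]; lra.
  by apply/negP => /andP[]; lra.
have nltm : n < m by rewrite lt_neqAle nm.
by exfalso; have := adm_double adm Jn Jm nltm; lra.
Qed.

(** The reflected box is again a box of length [B], displaced by at most [th]; hence T(t) z is x =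
    [box1 B] up to an edge error, plus a shifted copy of z. *)
Lemma Ta_box2 m (B th t x : R) : 0 < B -> 0 <= th -> inJ J m -> B + th < a m ->
  2 * a m - B - th <= t -> t <= 2 * a m - B -> 0 <= x ->
  (Hsub (Ta J a t (box2 B)) (box1 B)).1 x = (box B (2 * a m - t - x) - box B x)%:C%C /\
  (Hsub (Ta J a t (box2 B)) (box1 B)).2 x = (box B (x - t))%:C%C.
Proof.
move=> B0 th0 Jm am t1 t2 x0; split => /=.
  by rewrite /Lshift /= add0r (Va_cbox B0 th0 Jm am)// rmorphB.
rewrite subr0 /Rshift; case: ifPn => // xt.
by rewrite /box; case: ifP => // /andP[xt' _]; rewrite xt' in xt.
Qed.

(** [M] and [eta] depend only on the similarity, so that the index, the box and the times can be
    chosen afterwards. [chain_bound] yields M B <= 4 C B + 2 C M th; since M > 24 C and 8 C th <= B,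
    the right-hand side is less than M B. *)
Lemma no_chain (S S' : Hsp R -> Hsp R) : bounded_invertible S S' ->
  exists M : nat, exists2 eta : R, (0 < M)%N /\ 0 < eta &
  forall (n : int) (B th : R) (tau : nat -> R), 0 < B -> 0 <= th -> th <= eta * B ->
    (forall k, (k <= M)%N -> inJ J (n + k%:Z)) -> B + th < a n ->
    (forall k, (k <= M)%N ->
      2 * a (n + k%:Z) - B - th <= tau k <= 2 * a (n + k%:Z) - B) ->
    (forall k h, (k < M)%N -> inH h ->
      (nrmH (S (Ta J a (tau k.+1 - tau k) h)) <= (1 + M%:R^-1)%:E * nrmH (S h))%E) ->
    False.
Proof.
move=> SS'; have [C C0 H] := chain_bound SS'.
exists (Num.trunc (24 * C)).+1, (Num.min 1 (8 * C)^-1).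
  by split => //; rewrite lt_min ltr01 invr_gt0 mulr_gt0.
set M := (Num.trunc _).+1 => n B th tau0 B0 th0 thB Jnk0 an tauP0 step.
have M24 : 24 * C < M%:R by exact: truncnS_gt.
have M0 : 0 < M%:R :> R by rewrite ltr0n.
(* Freezing indices and times after [M] gives the remainders the uniform bounds over all k that
   [chain_bound] asks for. *)
pose nn k := n + (minn k M)%:Z; pose tau k := tau0 (minn k M).
have Jnk k : inJ J (nn k) by apply: Jnk0; exact: geq_minr.
have tauP k : 2 * a (nn k) - B - th <= tau k <= 2 * a (nn k) - B.
  by apply: tauP0; exact: geq_minr.
have ank k : B + th < a (nn k).
  apply: (lt_le_trans an); apply: (adm_le adm) => //; last by rewrite /nn; lia.
  by have := Jnk0 0%N (leq0n _); rewrite addr0.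
have tau_gt0 k : 0 < tau k by have /andP[] := tauP k; have := ank k; lra.
(* Gaps of at least [B] make the shifted boxes disjoint and let T(tau_(k+1) - tau_k) annihilate
   x. *)
have tau_sep i j : (i < j)%N -> (j <= M)%N -> tau i + B <= tau j.
  move=> ij jM; have : 2 * a (nn i) <= a (nn j) by apply: (adm_double adm) => //; rewrite /nn; lia.
  by have /andP[] := tauP i; have /andP[] := tauP j; have := ank i; lra.
pose x := box1 B; pose z := box2 B.
pose r k := Hsub (Ta J a (tau k) z) x.
have B0' := ltW B0.
have zk k : inH (Ta J a (tau k) z) by have [] := Ta_inH_le adm (tau_gt0 k) (inH_box2 B0').
have rH k : inH (r k) by apply: inHB => //; exact: inH_box1.
have [[S_H _] _] := SS'.
have Sb : bounded_op S by case: SS'.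
pose e k y := box B (2 * a (nn k) - tau k - y) - box B y.
pose v k y := box B (y - tau k).
have rE k y : 0 <= y -> (r k).1 y = (e k y)%:C%C /\ (r k).2 y = (v k y)%:C%C.
  by have /andP[t1 t2] := tauP k; exact: (Ta_box2 B0 th0 (Jnk k) (ank k) t1 t2).
have me k : measurable_fun Rp (e k).
  apply: measurable_funB; last by rewrite boxE; exact: measurable_indic.
  rewrite boxE; apply: measurableT_comp; first exact: measurable_indic.
  exact: measurable_funB.
have mv k : measurable_fun Rp (v k).
  rewrite /v boxE; apply: measurableT_comp; first exact: measurable_indic.
  exact: measurable_funB.
(* The edge errors for all k live on these same two intervals of length [th]. *)
pose E1 : set R := [set` `[0, th]]; pose E2 : set R := [set` `[B, B + th]].
have e0 k y : 0 <= y -> ~ E1 y -> ~ E2 y -> e k y = 0.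
  rewrite /E1 /E2 /= !in_itv/= => y0 /negP nE1 /negP nE2.
  have /andP[t1 t2] := tauP k; rewrite /e /box.
  have -> : (0 <= 2 * a (nn k) - tau k - y < B) = (0 <= y < B); last by rewrite subrr.
  move: nE1 nE2; rewrite y0 /= -ltNge negb_and -!ltNge => y1 /orP[y2|y2].
    by rewrite y2; apply/andP; split; lra.
  by apply/idP/idP => [/andP[]|]; lra.
have e1 k y : `|e k y| <= 1.
  by rewrite /e /box; do 2 case: ifP => _; rewrite ?subrr ?subr0 ?sub0r ?normrN ?normr1 ?normr0.
pose E := E1 `|` E2.
have mE : measurable E by apply: measurableU; exact: measurable_itv.
have muE : (mu E <= (2 * th)%:E)%E.
  apply: (le_trans (measureU2 _ _ _)); [exact: measurable_itv|exact: measurable_itv|].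
  rewrite mulr2n mulrDl mul1r EFinD; apply: leeD; apply: lebesgue_itv_le => //; lra.
have v_sqr k y : v k y ^+ 2 = v k y.
  by rewrite /v /box; case: ifP; rewrite ?expr1n ?expr0n.
have nv k : (nrm2 (fun y => (v k y)%:C%C) <= B%:E)%E.
  rewrite -[B in B%:E]mul1r.
  apply: (@nrm2_real_le _ _ [set` `[tau k, (tau k + B)[]) => //.
    by apply: lebesgue_itv_le => //; lra.
  move=> y y0; rewrite mul1r v_sqr indicE mem_setE in_itv/= /v /box.
  rewrite subr_ge0 ltrBlDl; case: ifP => // _; exact: lexx.
have fin_le h (l : R) : inH h -> (nrmH h <= l%:E)%E -> fine (nrmH h) <= l.
  by move=> hH hl; rewrite -lee_fin fineK// nrmH_fin.
have rb k : fine (nrmH (r k)) <= 3 * B.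
  apply: fin_le => //; rewrite (eq_nrmH (k := (fun y => (e k y)%:C%C, fun y => (v k y)%:C%C)));
    last by move=> y /(rE k).
  have : (nrm2 (fun y => (e k y)%:C%C) <= (1 * (2 * th))%:E)%E.
    apply: (nrm2_real_le (me k) mE) => // y y0.
    rewrite mul1r indicE; case: (boolP (y \in E)) => [_|/negP yE].
      by rewrite -(real_normK (num_real (e k y))) exprn_ile1.
    by rewrite e0 ?expr0n// => ?; apply: yE; rewrite inE; [left|right].
  move=> /leeD /(_ (nv k)) H1; apply: (le_trans H1).
  rewrite -EFinD lee_fin mul1r.
  have : Num.min 1 (8 * C)^-1 * B <= 1 * B by rewrite ler_wpM2r// ge_min lexx.
  lra.
pose r' k := r k.+1.
(* Edge errors may pile up, hence the factor M^2 on a set of measure [2 * th]; the shifted boxes are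
   disjoint and contribute only M B. *)
have sumb : fine (nrmH (hsum r' M)) <= M%:R ^+ 2 * (2 * th) + M%:R * B.
  apply: fin_le; first by apply: inH_hsum => k; exact: rH.
  rewrite (eq_nrmH (k := (fun y => (\sum_(k < M) e k.+1 y)%:C%C,
                          fun y => (\sum_(k < M) v k.+1 y)%:C%C))); last first.
    move=> y y0; rewrite /= !rmorph_sum; split; apply: eq_bigr => k _.
      by have [] := rE k.+1 y y0.
    by have [] := rE k.+1 y y0.
  rewrite EFinD; apply: leeD.
    apply: (nrm2_real_le _ mE) => //; first by apply: measurable_sum => k.
    move=> y y0; rewrite indicE; case: (boolP (y \in E)) => [_|/negP yE].
      rewrite mulr1 -(real_normK (num_real _)) ler_pXn2r ?nnegrE ?(ltW M0)//.
      apply: le_trans (ler_norm_sum _ _ _) _.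
      apply: (@le_trans _ _ (\sum_(k < M) 1)); first exact: ler_sum.
      by rewrite sumr_const card_ord.
    rewrite mulr0 big1 ?expr0n// => k _; rewrite e0// => ?; apply: yE; rewrite inE;
      [by left|by right].
  have sum_nn y : 0 <= y -> csq (\sum_(k < M) v k.+1 y)%:C%C = \sum_(k < M) csq (v k.+1 y)%:C%C.
    move=> y0; rewrite csq_real; under [RHS]eq_bigr do rewrite csq_real.
    have Hm m : (m <= M)%N -> (\sum_(k < m) v k.+1 y) ^+ 2 = \sum_(k < m) v k.+1 y ^+ 2.
      elim: m => [_|m IH mM]; first by rewrite !big_ord0 expr0n.
      rewrite !big_ord_recr /= sqrrD IH ?(ltnW mM)//.
      suff -> : (\sum_(k < m) v k.+1 y) * v m.+1 y = 0 by rewrite mul0rn addr0.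
      rewrite mulr_suml big1// => k _.
      have := tau_sep k.+1 m.+1 _ mM; rewrite ltnS ltn_ord => /(_ isT) sep.
      rewrite /v /box; case: ifP => [/andP[_ k1]|_]; last by rewrite mul0r.
      by case: ifP => [/andP[k2 _]|_]; [exfalso; lra|rewrite mulr0].
    exact: Hm.
  have -> : (nrm2 (fun y => (\sum_(k < M) v k.+1 y)%:C%C) =
      \int[mu]_(y in Rp) \sum_(k < M) (csq (v k.+1 y)%:C%C)%:E)%E.
    apply: eq_integral => y /set_mem; rewrite /= in_itv/= andbT => y0.
    by rewrite sum_nn// sumEFin.
  rewrite ge0_integral_sum//; last 2 first.
  - move=> k; apply/measurable_EFinP; apply: cmeasurable_csq.
    exact: measurable_real_cmeasurable.
  - by move=> k y _; rewrite lee_fin csq_ge0.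
  apply: (@le_trans _ _ (\sum_(k < M) B%:E)%E); first by apply: lee_sum => k _; exact: nv.
  by rewrite sumEFin lee_fin sumr_const card_ord mulr_natl.
have steps k : (k < M)%N ->
    (nrmH (S (Hadd x (r k.+1))) <= (1 + M%:R^-1)%:E * nrmH (S (r k)))%E.
  move=> kM; pose d := tau k.+1 - tau k.
  have dB : B <= d by have := tau_sep k k.+1 (ltnSn _) kM; rewrite /d; lra.
  have d0 : 0 < d by exact: lt_le_trans dB.
  (* By the semigroup law T(d) r_k = T(tau_(k+1)) z - T(d) x, and T(d) x = 0 because [d >= B]. *)
  have <- : nrmH (S (Ta J a d (r k))) = nrmH (S (Hadd x (r k.+1))).
    have T1 : inH (Ta J a d (r k)) by have [] := Ta_inH_le adm d0 (rH k).
    have T2 : inH (Hadd x (r k.+1)) by apply: inHD => //; exact: inH_box1.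
    apply: nrmHB0; [exact: S_H|exact: S_H|apply: bounded_opB => //].
    apply: nrmHB_eq0 => y y0; rewrite /r TaB.
    have dt : d + tau k = tau k.+1 by rewrite /d; lra.
    have := Ta_add adm z d0 (tau_gt0 k) y0; rewrite dt.
    have : (Ta J a d x).1 y = 0 /\ (Ta J a d x).2 y = 0.
      split; rewrite /= /Lshift /Rshift /Va /=; last by case: ifP.
      rewrite /cbox /box ifF; last by apply/negP => /andP[]; lra.
      by case: ifP; rewrite addr0.
    set A := Ta J a d (Ta _ _ _ z); set D := Ta J a d x; set T := Ta J a (tau k.+1) z.
    clearbody A D T => -[D1 D2] [A1 A2].
    by rewrite /Hsub /Hadd /= D1 D2 A1 A2; split; ring.
  have := step k (r k) kM (rH k).
  by rewrite /d /tau !(minn_idPl _)// ltnW.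
have := H M x r (3 * B) (M%:R ^+ 2 * (2 * th) + M%:R * B) (ltn0Sn _) (inH_box1 B0') rH steps rb sumb.
rewrite nrmH_box1//= => fin.
have th8 : C * (8 * th) <= B.
  have : th <= (8 * C)^-1 * B.
    by apply: (le_trans thB); rewrite ler_wpM2r// ge_min lexx orbT.
  by rewrite ler_pdivlMl ?mulr_gt0//; lra.
have : C * (3 * B + (M%:R ^+ 2 * (2 * th) + M%:R * B) / M%:R) = 4 * (C * B) + M%:R * (C * (2 * th)).
  by field; rewrite gt_eqF.
move=> E3; rewrite E3 in fin.
have : M%:R * (C * (8 * th)) <= M%:R * B by rewrite ler_pM2l.
have : 24 * C * B < M%:R * B by rewrite ltr_pM2r.
have : 0 < C * B by rewrite mulr_gt0.
lra.
Qed.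

End indicator_orbits.

(** * Contradictions from long chains of reflections *)

Section necessity.
Context {R : realType} (J : index_kind) (a : int -> R).
Hypothesis adm : admissible_seq J a.
Implicit Types (h : Hsp R) (S : Hsp R -> Hsp R).

(** Applying the hypothesis to [S h] replaces the conjugated operator by T(t) itself, measured in
    the equivalent norm [nrmH (S h)]. *)
Lemma similarity_le S S' (t K : R) : bounded_invertible S S' -> 0 < t ->
  (forall h, inH h -> (nrmH (S (Ta J a t (S' h))) <= K%:E * nrmH h)%E) ->
  forall h, inH h -> (nrmH (S (Ta J a t h)) <= K%:E * nrmH (S h))%E.
Proof.
move=> [Sb [[S'H _] [_ S'S]]] t0 H h hH; have [SH _] := Sb.
have S'Sh : inH (S' (S h)) by exact/S'H/SH.
have [T1 _] := Ta_inH_le adm t0 S'Sh; have [T2 _] := Ta_inH_le adm t0 hH.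
have <- : nrmH (S (Ta J a t (S' (S h)))) = nrmH (S (Ta J a t h)).
  apply: nrmHB0; [exact: SH|exact: SH|apply: bounded_opB => //].
  rewrite -TaB; apply/eqP; rewrite eq_le nrmH_ge0 andbT.
  have [_ le] := Ta_inH_le adm t0 (inHB S'Sh hH); apply: (le_trans le).
  by rewrite S'S// mule0.
exact/H/SH.
Qed.

Lemma contraction_iter S (t : R) (j : nat) : bounded_op S -> 0 < t ->
  (forall h, inH h -> (nrmH (S (Ta J a t h)) <= nrmH (S h))%E) ->
  forall h, inH h -> (nrmH (S (Ta J a (j.+1%:R * t) h)) <= nrmH (S h))%E.
Proof.
move=> Sb t0 H h hH; have [SH _] := Sb; elim: j => [|j IH]; first by rewrite mul1r; exact: H.
have jt0 : 0 < j.+1%:R * t by rewrite mulr_gt0.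
have jSt0 : 0 < j.+2%:R * t by rewrite mulr_gt0.
have [T1 _] := Ta_inH_le adm jt0 hH; have [T2 _] := Ta_inH_le adm jSt0 hH.
have [T3 _] := Ta_inH_le adm t0 T1.
apply: le_trans IH; apply: le_trans (H _ T1).
suff -> : nrmH (S (Ta J a (j.+2%:R * t) h)) = nrmH (S (Ta J a t (Ta J a (j.+1%:R * t) h))) by [].
apply: nrmHB0; [exact: SH|exact: SH|apply: bounded_opB => //].
apply: nrmHB_eq0 => x x0; have := Ta_add adm h t0 jt0 x0.
have -> : t + j.+1%:R * t = j.+2%:R * t by rewrite -[j.+2%:R]natr1; ring.
by move=> [-> ->].
Qed.

(** Only multiples of [t] are available, so each time is the largest multiple not exceeding
    [2 * a (n + k) - B], with error at most th = t. Unbounded terms leave room for a box so long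
    that this error is relatively small. *)
Lemma not_similar_to_contraction (t : R) : J <> JZminus -> 0 < t ->
  ~ similar_to_contraction (Ta J a t).
Proof.
move=> JN t0 [S [S' [SS' H]]].
have [Sb _] := SS'.
have J0 (k : int) : 0 <= k -> inJ J k by case: (J) JN.
have H1 h : inH h -> (nrmH (S (Ta J a t h)) <= nrmH (S h))%E.
  move=> hH; rewrite -[leRHS]mul1e; apply: (similarity_le SS' t0) => // k kH.
  by rewrite mul1e; exact: H.
have [M [eta [M0 eta0] chain]] := no_chain adm SS'.
(* This choice makes [t <= eta * B] an equality. *)
pose B := t / eta; have B0 : 0 < B by rewrite divr_gt0.
have [n n0 an] := adm_unbounded adm (B + t + 1) JN.
pose m k := Num.trunc ((2 * a (n + k%:Z) - B) / t).
have ank k : B + t < a (n + k%:Z).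
  have : a n <= a (n + k%:Z) by apply: (adm_le adm); rewrite ?J0//; lia.
  by lra.
have mP k : 2 * a (n + k%:Z) - B - t <= (m k)%:R * t <= 2 * a (n + k%:Z) - B.
  have pos : 0 <= (2 * a (n + k%:Z) - B) / t.
    by rewrite divr_ge0 ?(ltW t0)//; have := ank k; lra.
  have := truncn_itv pos; rewrite -/(m k) => /andP[m1 m2].
  rewrite ler_pdivlMr// in m1; rewrite ltr_pdivrMr// -natr1 mulrDl mul1r in m2.
  by apply/andP; split; lra.
apply: (chain n B t (fun k => (m k)%:R * t)) => //.
- exact: ltW.
- by rewrite /B mulrC divfK// gt_eqF.
- by move=> k _; rewrite J0//; lia.
- by have := ank 0%N; rewrite addr0.
move=> k h kM hH.
have mlt : (m k < m k.+1)%N.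
  rewrite -(ltr_nat R) -(ltr_pM2r t0).
  have d : 2 * a (n + k%:Z) <= a (n + k.+1%:Z).
    by apply: (adm_double adm); rewrite ?J0//; lia.
  by have /andP[_ m1] := mP k; have /andP[m2 _] := mP k.+1; have := ank k; lra.
have -> : (m k.+1)%:R * t - (m k)%:R * t = (m k.+1 - m k).-1.+1%:R * t.
  by rewrite prednK ?subn_gt0// natrB ?mulrBl// ltnW.
apply: (le_trans (contraction_iter _ Sb t0 H1 hH)).
by rewrite lee_pemull ?nrmH_ge0// lee_fin lerDl invr_ge0.
Qed.

(** All times are available, so th = 0. Arbitrarily small terms let the whole chain take place in so
    short a time that each growth factor is at most 1 + 1/M. *)
Lemma not_similar_to_quasi_contraction : J <> JZplus ->
  ~ similar_to_quasi_contraction_sg (Ta J a).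
Proof.
move=> JN [S [S' [lam [SS' H]]]].
have J0 (k : int) : k <= 0 -> inJ J k by case: (J) JN.
have [M [eta [M0 eta0] chain]] := no_chain adm SS'.
have M0' : 0 < M%:R :> R by rewrite ltr0n.
have l0 : 0 < `|lam| + 1 by rewrite ltr_wpDl.
have ln0 : 0 < ln (1 + M%:R^-1 : R) by rewrite ln_gt0// ltrDl invr_gt0.
(* Each time step is at most [2 * e] and the squared norm doubles the exponent, hence the 4; the
   added 1 keeps the denominator positive when [lam] is 0. *)
pose e := ln (1 + M%:R^-1) / (4 * (`|lam| + 1)).
have e0 : 0 < e by rewrite divr_gt0// mulr_gt0.
have [m m0 am] := adm_vanishing adm JN e0.
(* The chain of M + 1 indices ends at [m], so all its terms are at most [a m < e]. *)
pose n := m - M%:Z.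
have Jn (k : nat) : (k <= M)%N -> inJ J (n + k%:Z) by move=> kM; apply: J0; rewrite /n; lia.
have Jm : inJ J m by exact: J0.
have an : 0 < a n by apply: (adm_gt0 adm); have := Jn 0%N (leq0n _); rewrite addr0.
pose B := a n / 2.
apply: (chain n B 0 (fun k => 2 * a (n + k%:Z) - B)) => //.
- by rewrite divr_gt0.
- by rewrite mulr_ge0 ?(ltW eta0)// divr_ge0// ltW.
- by rewrite addr0 /B; lra.
- by move=> k kM; rewrite subr0 lexx.
move=> k h kM hH.
have J1 := Jn k (ltnW kM); have J2 := Jn _ kM.
have lt : a (n + k%:Z) < a (n + k.+1%:Z) by apply: (adm_lt adm J1 J2); lia.
have pk : 0 < a (n + k%:Z) by exact: (adm_gt0 adm).
have le : a (n + k.+1%:Z) <= a m by apply: (adm_le adm J2 Jm); rewrite /n; lia.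
set d := _ - _; have d0 : 0 < d by rewrite /d; lra.
have de : d <= 2 * e by rewrite /d; lra.
apply: le_trans (similarity_le SS' d0 (H d (ltW d0)) hH) _.
apply: lee_wpmul2r; first exact: nrmH_ge0.
rewrite lee_fin -expRM_natl -[leRHS]lnK ?posrE; last by rewrite addr_gt0// invr_gt0.
rewrite ler_expR.
have -> : ln (1 + M%:R^-1) = 2 * ((`|lam| + 1) * (2 * e)).
  by rewrite /e; field; rewrite gt_eqF.
rewrite ler_pM2l//; apply: (@le_trans _ _ ((`|lam| + 1) * d)); last by rewrite ler_pM2l.
by rewrite ler_pM2r//; apply: le_trans (ler_norm _) _; rewrite lerDl.
Qed.

End necessity.

Theorem theorem7p1 (R : realType) (J : index_kind) (a : int -> R) :
  admissible_seq J a ->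
  (forall t : R, 0 < t -> (similar_to_contraction (Ta J a t) <-> J = JZminus)) /\
  (similar_to_quasi_contraction_sg (Ta J a) <-> J = JZplus).
Proof.
move=> adm; split=> [t t0|]; split.
- move=> sim; case: (pselect (J = JZminus)) => // JN.
  by have := not_similar_to_contraction adm JN t0.
- by move=> EJ; subst J; exact: similar_to_contraction_JZminus.
- move=> sim; case: (pselect (J = JZplus)) => // JN.
  by have := not_similar_to_quasi_contraction adm JN.
- by move=> EJ; subst J; exact: similar_to_quasi_contraction_JZplus.
Qed.
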